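(* Let $G$ be a finite group. For any $G$-Tambara functor $k$ and any subgroup $H \subset G$, the canonical map (adjunction unit) $$k \rightarrow \mathrm{CoInd}_H^G \mathrm{Res}_H^G k$$ is étale.
   Context: Mackey, (commutative) Green and Tambara functors for a finite group $G$ have their standard meaning: a $G$-Tambara functor $k$ has commutative rings $k(X)$ for finite $G$-sets $X$, with restrictions $\mathrm{Res}$, transfers $\mathrm{Tr}$ and norms $\mathrm{Nm}$. A module over a Tambara functor is a module over its underlying Green functor. A $k$-algebra is a Tambara functor $R$ with a morphism $k \to R$. $\boxtimes_k$ is the relative box product over $k$. Restriction and coinduction. For $H \subset G$, $\mathrm{Res}_H^G$ sends $G$-Tambara functors to $H$-Tambara functors by $(\mathrm{Res}_H^G k)(X) = k(G \times_H X)$. Its right adjoint is $\mathrm{CoInd}_H^G$, with $(\mathrm{CoInd}_H^G \ell)(X) = \ell(\mathrm{res}_H^G X)$, where $\mathrm{res}_H^G X$ is $X$ viewed as an $H$-set. Étale. A $k$-module $M$ is flat if $M \boxtimes_k -$ is exact on $k$-modules. The free polynomial $k$-algebra on a generator in level $X$ ($X$ a finite $G$-set) is the $k$-algebra representing $R \mapsto R(X)$. A $k$-algebra is finitely presented if it is the coequalizer of a pair of maps between free polynomial $k$-algebras on finitely many generators. A Tambara ideal is the (levelwise) kernel of a morphism of Tambara functors. For a Tambara ideal $I$, $I^{>1}$ is the sub-ideal of $I$ generated by all nontrivial norms (including products) of elements of $I$: in level $G/H$ by $I(G/H)^2$ together with the images of all norms $I(G/K) \to I(G/H)$ for $K$ conjugate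 to a proper subgroup of $H$. For a $k$-algebra $R$ with $I = \ker(R \boxtimes_k R \to R)$ (multiplication), the genuine Kähler differentials are $\Omega^{1,\mathrm{Tamb}}_{R/k} := I/I^{>1}$. A morphism $k \to R$ is formally étale if $R$ is flat as a $k$-module and $\Omega^{1,\mathrm{Tamb}}_{R/k} = 0$; it is étale if it is moreover finitely presented. *)

(* Defs.v *)
From HB Require Import structures.
From mathcomp Require Import all_boot all_order all_fingroup all_algebra.
From mathcomp Require Import ring_quotient.
From mathcomp Require Import boolp.

Set Implicit Arguments.
Unset Strict Implicit.
Unset Printing Implicit Defensive.

Import GRing.Theory.
Local Open Scope ring_scope.

(** * Finite G-sets

    As everywhere in MathComp, actions are right actions: [gact X x g] is
    [x . g].  Left G-sets are the same thing via [g |-> g^-1]; under this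
    identification [G x_H X] becomes [X x_H G] and [G/H] becomes the set of
    right cosets of [H]. *)

Record Gset (G : finGroupType) := MkGset {
  gcar :> finType;
  gact : {action G &-> gcar} }.

Record Gmap (G : finGroupType) (X Y : Gset G) := MkGmap {
  gfun :> X -> Y;
  gmapP : forall (x : X) (g : G), gfun (gact X x g) = gact Y (gfun x) g }.

Definition gid (G : finGroupType) (X : Gset G) : Gmap X X :=
  @MkGmap G X X (fun x => x) (fun _ _ => erefl).

Lemma gcomp_subproof (G : finGroupType) (X Y Z : Gset G)
    (f : Gmap Y Z) (g : Gmap X Y) (x : X) (a : G) :
  f (g (gact X x a)) = gact Z (f (g x)) a.
Proof. by rewrite !gmapP. Qed.

Definition gcomp (G : finGroupType) (X Y Z : Gset G)
    (f : Gmap Y Z) (g : Gmap X Y) : Gmap X Z :=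
  @MkGmap G X Z (fun x => f (g x)) (gcomp_subproof f g).

Lemma gmap_ext (G : finGroupType) (X Y : Gset G) (f g : Gmap X Y) :
  (forall x, f x = g x) -> f = g.
Proof.
case: f g => [f fP] [g gP] /= /funext efg.
by case: _ / efg gP => gP; congr MkGmap; apply: Prop_irrelevance.
Qed.

(** Limits and colimits of G-sets are computed on underlying sets, so the
    diagrams entering the axioms of a Tambara functor are characterized
    elementwise. *)

(* [X -i-> Z <-j- Y] exhibits [Z] as the disjoint union of [X] and [Y]. *)
Definition is_coproduct (G : finGroupType) (X Y Z : Gset G)
    (i : Gmap X Z) (j : Gmap Y Z) : Prop :=
  bijective (fun s : X + Y => match s with inl x => i x | inr y => j y end).

(*   Z --b--> Y
     |a       |g
     v        v
     X --f--> W   *)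
Definition is_pullback (G : finGroupType) (X Y Z W : Gset G)
    (a : Gmap Z X) (b : Gmap Z Y) (f : Gmap X W) (g : Gmap Y W) : Prop :=
  (forall z, f (a z) = g (b z)) /\
  (forall x y, f x = g y -> exists! z, a z = x /\ b z = y).

(* The exponential diagram of [A -p-> X -f-> Y]:

      X <-p- A <-e- Z
      |f            |f'
      v             v
      Y <----q----- E

   where [E] is the dependent product of [p] along [f] (the fibre of [q] over
   [y] is the set of sections of [p] over [f^-1(y)]), [Z = X x_Y E] and [e] is
   the evaluation. *)
Definition is_exponential (G : finGroupType) (X Y A Z E : Gset G)
    (f : Gmap X Y) (p : Gmap A X) (e : Gmap Z A) (f' : Gmap Z E)
    (q : Gmap E Y) : Prop :=
  is_pullback (gcomp p e) f' f q /\
  (forall (y : Y) (s : {x : X | f x == y} -> A),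
     (forall x, p (s x) = val x) ->
     exists! t : E, q t = y /\
       forall z : Z, f' z = t ->
       forall h : f (p (e z)) == y, e z = s (exist _ (p (e z)) h)).

(** * Mackey, Green and Tambara functors *)

Record is_mackey (G : finGroupType) (M : Gset G -> zmodType)
    (res : forall X Y : Gset G, Gmap X Y -> {additive M Y -> M X})
    (tr : forall X Y : Gset G, Gmap X Y -> {additive M X -> M Y}) : Prop :=
  IsMackey {
  mk_res_id : forall X (m : M X), res X X (gid X) m = m;
  mk_res_comp : forall X Y Z (f : Gmap Y Z) (g : Gmap X Y) (m : M Z),
    res X Z (gcomp f g) m = res X Y g (res Y Z f m);
  mk_tr_id : forall X (m : M X), tr X X (gid X) m = m;
  mk_tr_comp : forall X Y Z (f : Gmap Y Z) (g : Gmap X Y) (m : M X),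
    tr X Z (gcomp f g) m = tr Y Z f (tr X Y g m);
  mk_pullback : forall X Y Z W (a : Gmap Z X) (b : Gmap Z Y)
      (f : Gmap X W) (g : Gmap Y W), is_pullback a b f g ->
    forall m : M X, res Y W g (tr X W f m) = tr Z Y b (res Z X a m);
  mk_empty : forall X : Gset G, (X -> False) -> forall m : M X, m = 0;
  mk_coproduct : forall X Y Z (i : Gmap X Z) (j : Gmap Y Z),
    is_coproduct i j ->
    bijective (fun m : M Z => (res X Z i m, res Y Z j m)) }.

(* [comPzRingType]: the zero ring must be allowed, since [k] vanishes on the empty G-set. *)
Record Green (G : finGroupType) := MkGreen {
  gr :> Gset G -> comPzRingType;
  res : forall X Y : Gset G, Gmap X Y -> {rmorphism gr Y -> gr X};
  tr : forall X Y : Gset G, Gmap X Y -> {additive gr X -> gr Y};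
  green_mackey : is_mackey (M := gr) res tr;
  frobenius : forall X Y (f : Gmap X Y) (a : gr X) (b : gr Y),
    tr f (a * res f b) = tr f a * b }.

Record Tambara (G : finGroupType) := MkTambara {
  tgreen :> Green G;
  nm : forall X Y : Gset G, Gmap X Y -> tgreen X -> tgreen Y;
  nm_morph : forall X Y (f : Gmap X Y), monoid_morphism (nm f);
  nm_id : forall X (a : tgreen X), nm (gid X) a = a;
  nm_comp : forall X Y Z (f : Gmap Y Z) (g : Gmap X Y) (a : tgreen X),
    nm (gcomp f g) a = nm f (nm g a);
  nm_pullback : forall X Y Z W (a : Gmap Z X) (b : Gmap Z Y)
      (f : Gmap X W) (g : Gmap Y W), is_pullback a b f g ->
    forall m : tgreen X, res tgreen g (nm f m) = nm b (res tgreen a m);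
  nm_tr : forall X Y A Z E (f : Gmap X Y) (p : Gmap A X) (e : Gmap Z A)
      (f' : Gmap Z E) (q : Gmap E Y), is_exponential f p e f' q ->
    forall a : tgreen A,
      nm f (tr tgreen p a) = tr tgreen q (nm f' (res tgreen e a)) }.

Record TambHom (G : finGroupType) (k l : Tambara G) := MkTambHom {
  thom :> forall X : Gset G, {rmorphism k X -> l X};
  thom_res : forall X Y (f : Gmap X Y) (a : k Y),
    thom X (res k f a) = res l f (thom Y a);
  thom_tr : forall X Y (f : Gmap X Y) (a : k X),
    thom Y (tr k f a) = tr l f (thom X a);
  thom_nm : forall X Y (f : Gmap X Y) (a : k X),
    thom Y (nm f a) = nm f (thom X a) }.

(** * Restriction and coinduction *)

Section RestrictedGset.
Variables (G : finGroupType) (H : {group G}) (X : Gset G).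

Definition rgset_act (x : X) (h : subg_of H) : X := gact X x (sgval h).

Lemma rgset_act1 x : rgset_act x 1%g = x.
Proof. exact: act1. Qed.

Lemma rgset_actM x : act_morph rgset_act x.
Proof. by move=> a b; rewrite /rgset_act /= actM. Qed.

(* [res_H^G X] *)
Definition rgset : Gset (subg_of H) :=
  @MkGset (subg_of H) X (TotalAction rgset_act1 rgset_actM).
End RestrictedGset.
Arguments rgset {G} H X.

Lemma rgmap_subproof (G : finGroupType) (H : {group G}) (X Y : Gset G)
    (f : Gmap X Y) (x : rgset H X) (h : subg_of H) :
  f (gact (rgset H X) x h) = gact (rgset H Y) (f x) h.
Proof. exact: gmapP. Qed.

Definition rgmap (G : finGroupType) (H : {group G}) (X Y : Gset G)
    (f : Gmap X Y) : Gmap (rgset H X) (rgset H Y) :=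
  @MkGmap _ (rgset H X) (rgset H Y) f (rgmap_subproof f).

Section InducedGset.
Variables (G : finGroupType) (H : {group G}) (X : Gset (subg_of H)).

Definition ind_act (p : X * G) (h : subg_of H) : X * G :=
  (gact X p.1 h, ((sgval h)^-1 * p.2)%g).

Lemma ind_act1 p : ind_act p 1%g = p.
Proof. by case: p => x g; rewrite /ind_act /= act1 invg1 mul1g. Qed.

Lemma ind_actM p : act_morph ind_act p.
Proof.
by move=> a b; rewrite /ind_act /= actM invMg mulgA.
Qed.

Definition ind_action : {action (subg_of H) &-> (X * G)%type} :=
  TotalAction ind_act1 ind_actM.

(* The carrier of [X x_H G]: the quotient of [X * G] by the relation
   [(x . h, g) ~ (x, h * g)]. *)
Definition ind_car : finType :=
  {O : {set X * G} | O \in [set orbit ind_action setT p | p in setT]}.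

Lemma cls_subproof (p : X * G) :
  orbit ind_action setT p \in [set orbit ind_action setT p | p in setT].
Proof. exact: imset_f. Qed.

Definition cls (x : X) (g : G) : ind_car :=
  exist _ (orbit ind_action setT (x, g)) (cls_subproof (x, g)).

Lemma cls_surj_pair (O : ind_car) : exists p : X * G, cls p.1 p.2 == O.
Proof.
case: O => O hO; have /imsetP [[x g] _ eO] := hO.
by exists (x, g); apply/eqP/val_inj.
Qed.

Definition cls_repr (O : ind_car) : X * G := xchoose (cls_surj_pair O).

Lemma cls_reprK O : cls (cls_repr O).1 (cls_repr O).2 = O.
Proof. exact/eqP/(xchooseP (cls_surj_pair O)). Qed.

Lemma cls_surj (O : ind_car) : exists x g, O = cls x g.
Proof. by exists (cls_repr O).1, (cls_repr O).2; rewrite cls_reprK. Qed.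

Lemma cls_eqP x g x' g' :
  cls x g = cls x' g' <->
  exists h : subg_of H, x' = gact X x h /\ g' = ((sgval h)^-1 * g)%g.
Proof.
split=> [/(congr1 val) /= /eqP|[h [-> ->]]].
  rewrite eq_sym => /eqP e.
  have: (x', g') \in orbit ind_action setT (x, g) by rewrite -e orbit_refl.
  by case/orbitP=> h _ [<- <-]; exists h.
apply: val_inj => /=; apply/esym.
by have := orbit_act ind_action (x, g) (in_setT h); apply.
Qed.

Lemma cls_act x g h : cls (gact X x h) g = cls x (sgval h * g)%g.
Proof.
apply/esym/cls_eqP; exists h; split=> //.
by rewrite mulgA mulVg mul1g.
Qed.

Definition ind_gact (O : ind_car) (g : G) : ind_car :=
  cls (cls_repr O).1 ((cls_repr O).2 * g)%g.

Lemma ind_gactE x a g : ind_gact (cls x a) g = cls x (a * g)%g.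
Proof.
rewrite /ind_gact; have /cls_eqP [h [-> ->]] := esym (cls_reprK (cls x a)).
by rewrite cls_act !mulgA mulgV mul1g.
Qed.

Lemma ind_gact1 O : ind_gact O 1%g = O.
Proof. by have [x [a ->]] := cls_surj O; rewrite ind_gactE mulg1. Qed.

Lemma ind_gactM O : act_morph ind_gact O.
Proof.
by move=> a b; have [x [c ->]] := cls_surj O; rewrite !ind_gactE mulgA.
Qed.

(* [X x_H G] *)
Definition igset : Gset G := @MkGset G ind_car (TotalAction ind_gact1 ind_gactM).

Lemma igset_actE x a g : gact igset (cls x a) g = cls x (a * g)%g.
Proof. exact: ind_gactE. Qed.

Lemma cls_inj g : injective (cls^~ g).
Proof.
move=> x x' /cls_eqP [h [-> e]].
have h1 : sgval h = 1%g by apply/invg_inj/(mulIg g); rewrite -e invg1 mul1g.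
by rewrite (_ : h = 1%g) ?act1 //; apply: val_inj.
Qed.
End InducedGset.

Lemma inj_surj_bij (A B : Type) (f : A -> B) :
  injective f -> (forall b, exists a, f a = b) -> bijective f.
Proof.
move=> inj surj; exists (fun b => projT1 (cid (surj b))) => [a|b].
  by apply: inj; case: cid.
by case: cid.
Qed.

Section InducedMap.
Variables (G : finGroupType) (H : {group G}).

Definition ind_map (X Y : Gset (subg_of H)) (f : Gmap X Y)
    (O : igset X) : igset Y := cls (f (cls_repr O).1) (cls_repr O).2.

Lemma ind_mapE (X Y : Gset (subg_of H)) (f : Gmap X Y) x g :
  ind_map f (cls x g) = cls (f x) g.
Proof.
rewrite /ind_map; have /cls_eqP [h [-> ->]] := esym (cls_reprK (cls x g)).
by rewrite gmapP cls_act mulgA mulgV mul1g.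
Qed.

Lemma ind_map_subproof (X Y : Gset (subg_of H)) (f : Gmap X Y)
    (O : igset X) (g : G) :
  ind_map f (gact (igset X) O g) = gact (igset Y) (ind_map f O) g.
Proof.
by have [x [a ->]] := cls_surj O; rewrite igset_actE !ind_mapE igset_actE.
Qed.

(* [f x_H G] *)
Definition igmap (X Y : Gset (subg_of H)) (f : Gmap X Y) :
  Gmap (igset X) (igset Y) := MkGmap (ind_map_subproof f).

Lemma igmapE (X Y : Gset (subg_of H)) (f : Gmap X Y) x g :
  igmap f (cls x g) = cls (f x) g.
Proof. exact: ind_mapE. Qed.

Lemma igmap_id (X : Gset (subg_of H)) : igmap (gid X) = gid (igset X).
Proof.
by apply: gmap_ext => O; have [x [g ->]] := cls_surj O; rewrite igmapE.
Qed.

Lemma igmap_comp (X Y Z : Gset (subg_of H)) (f : Gmap Y Z) (g : Gmap X Y) :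
  igmap (gcomp f g) = gcomp (igmap f) (igmap g).
Proof.
by apply: gmap_ext => O; have [x [a ->]] := cls_surj O; rewrite /= !ind_mapE.
Qed.

Lemma igmap_fibre (X Y : Gset (subg_of H)) (f : Gmap X Y) (O : igset X) y g :
  igmap f O = cls y g -> exists2 x, O = cls x g & f x = y.
Proof.
have [x [a ->]] := cls_surj O; rewrite igmapE => /cls_eqP [h [-> ->]].
exists (gact X x h); last by rewrite gmapP.
by rewrite cls_act mulgA mulgV mul1g.
Qed.

Lemma igset_empty (X : Gset (subg_of H)) : (X -> False) -> igset X -> False.
Proof. by move=> X0 O; have [x _] := cls_surj O; exact: X0 x. Qed.

Lemma igmap_coproduct (X Y Z : Gset (subg_of H)) (i : Gmap X Z) (j : Gmap Y Z) :
  is_coproduct i j -> is_coproduct (igmap i) (igmap j).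
Proof.
case=> c cK Kc.
have inj := can_inj cK.
apply: inj_surj_bij => [s s'|O].
  case: s s' => O [] O'; have [x [g ->]] := cls_surj O;
    rewrite igmapE => /esym/igmap_fibre [x' ->].
  - by move=> e; move: (inj (inl x') (inl x) e) => [->].
  - by move=> e; move: (inj (inr x') (inl x) e).
  - by move=> e; move: (inj (inl x') (inr x) e).
  - by move=> e; move: (inj (inr x') (inr x) e) => [->].
have [z [g ->]] := cls_surj O; have := Kc z.
case: (c z) => x <-; first by exists (inl (cls x g)); exact: igmapE.
by exists (inr (cls x g)); exact: igmapE.
Qed.

Lemma igmap_pullback (X Y Z W : Gset (subg_of H))
    (a : Gmap Z X) (b : Gmap Z Y) (f : Gmap X W) (g : Gmap Y W) :
  is_pullback a b f g ->
  is_pullback (igmap a) (igmap b) (igmap f) (igmap g).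
Proof.
move=> [comm univ]; split=> [O|O O'].
  by have [z [c ->]] := cls_surj O; rewrite !igmapE comm.
have [y [c ->]] := cls_surj O'; rewrite igmapE => /igmap_fibre [x -> e].
have [z [[ea eb] uniq]] := univ _ _ e.
exists (cls z c); split; first by rewrite !igmapE ea eb.
move=> O1 [/igmap_fibre [z1 -> e1]]; rewrite igmapE => /cls_inj e2.
by rewrite (uniq z1).
Qed.

Lemma igmap_exponential (X Y A Z E : Gset (subg_of H))
    (f : Gmap X Y) (p : Gmap A X) (e : Gmap Z A) (f' : Gmap Z E)
    (q : Gmap E Y) :
  is_exponential f p e f' q ->
  is_exponential (igmap f) (igmap p) (igmap e) (igmap f') (igmap q).
Proof.
move=> [pb univ]; split; first by rewrite -igmap_comp; exact: igmap_pullback.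
move=> O s sP; have [y [g eO]] := cls_surj O; subst O.
have fib (x : {x : X | f x == y}) : igmap f (cls (val x) g) == cls y g.
  by rewrite igmapE (eqP (valP x)).
have s_cls (x : {x : X | f x == y}) :
    exists a, s (exist _ (cls (val x) g) (fib x)) = cls a g /\ p a = val x.
  have /igmap_fibre [a ea pa] := sP (exist _ (cls (val x) g) (fib x)).
  by exists a.
pose s' x := projT1 (cid (s_cls x)).
have s'P x : p (s' x) = val x by rewrite /s'; case: cid => a [].
have sE x (hx : f x == y) u (hu : igmap f u == cls y g) :
    u = cls x g -> s (exist _ u hu) = cls (s' (exist _ x hx)) g.
  move=> eu; subst u; rewrite /s'; case: cid => a [<- _].
  by congr s; apply: val_inj.
have [t [[qt tP] uniq]] := univ y s' s'P.
exists (cls t g); split.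
  split=> [|O1]; first by rewrite igmapE qt.
  move=> /igmap_fibre [z eO1 ez] h; subst O1.
  have hz : f (p (e z)) == y.
    by rewrite (proj1 pb z : f (p (e z)) = _) ez qt.
  have eu : igmap p (igmap e (cls z g)) = cls (p (e z)) g by rewrite !igmapE.
  by rewrite (sE _ hz _ h eu) -(tP z ez hz) igmapE.
move=> O1 [/igmap_fibre [t1 eO1 qt1] t1P]; subst O1; congr cls.
apply: uniq; split=> // z ez hz; apply: (@cls_inj _ _ _ g).
have eu : igmap p (igmap e (cls z g)) = cls (p (e z)) g by rewrite !igmapE.
have h : igmap f (igmap p (igmap e (cls z g))) == cls y g.
  by rewrite eu igmapE (eqP hz).
have ez' : igmap f' (cls z g) = cls t1 g by rewrite igmapE ez.
by rewrite -(sE _ hz _ h eu) -(t1P _ ez' h) igmapE.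
Qed.
End InducedMap.

(* [(Res_H^G k)(X) = k(X x_H G)] *)
Section ResTambara.
Variables (G : finGroupType) (H : {group G}) (k : Tambara G).
Implicit Types X Y : Gset (subg_of H).

Definition resT_gr X : comPzRingType := k (igset X).
Definition resT_res X Y (f : Gmap X Y) : {rmorphism resT_gr Y -> resT_gr X} :=
  res k (igmap f).
Definition resT_tr X Y (f : Gmap X Y) : {additive resT_gr X -> resT_gr Y} :=
  tr k (igmap f).

Lemma resT_mackey : is_mackey (M := resT_gr) resT_res resT_tr.
Proof.
have [ri rc ti tc pb em co] := green_mackey k.
split=> *; rewrite /resT_res /resT_tr.
- by rewrite igmap_id; apply: ri.
- by rewrite igmap_comp; apply: rc.
- by rewrite igmap_id; apply: ti.
- by rewrite igmap_comp; apply: tc.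
- by apply: pb; apply: igmap_pullback.
- by apply: em; apply: igset_empty.
- by apply: co; apply: igmap_coproduct.
Qed.

Lemma resT_frobenius X Y (f : Gmap X Y) (a : resT_gr X) (b : resT_gr Y) :
  resT_tr f (a * resT_res f b) = resT_tr f a * b.
Proof. exact: frobenius. Qed.

Definition resT_green : Green (subg_of H) := MkGreen resT_mackey resT_frobenius.

Definition resT_nm X Y (f : Gmap X Y) : resT_green X -> resT_green Y :=
  nm (t := k) (igmap f).

Lemma resT_nm_morph X Y (f : Gmap X Y) : monoid_morphism (resT_nm f).
Proof. exact: nm_morph. Qed.

Lemma resT_nm_id X (a : resT_green X) : resT_nm (gid X) a = a.
Proof. by rewrite /resT_nm igmap_id; apply: nm_id. Qed.

Lemma resT_nm_comp X Y Z (f : Gmap Y Z) (g : Gmap X Y) (a : resT_green X) :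
  resT_nm (gcomp f g) a = resT_nm f (resT_nm g a).
Proof. by rewrite /resT_nm igmap_comp; apply: nm_comp. Qed.

Lemma resT_nm_pullback X Y Z W (a : Gmap Z X) (b : Gmap Z Y)
    (f : Gmap X W) (g : Gmap Y W) : is_pullback a b f g ->
  forall m : resT_green X,
    res resT_green g (resT_nm f m) = resT_nm b (res resT_green a m).
Proof. by move=> pb m; apply: nm_pullback; apply: igmap_pullback. Qed.

Lemma resT_nm_tr X Y A Z E (f : Gmap X Y) (p : Gmap A X) (e : Gmap Z A)
    (f' : Gmap Z E) (q : Gmap E Y) : is_exponential f p e f' q ->
  forall a : resT_green A,
    resT_nm f (tr resT_green p a) =
    tr resT_green q (resT_nm f' (res resT_green e a)).
Proof. by move=> ex a; apply: nm_tr; apply: igmap_exponential. Qed.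

Definition ResT : Tambara (subg_of H) :=
  MkTambara resT_nm_morph resT_nm_id resT_nm_comp resT_nm_pullback resT_nm_tr.
End ResTambara.

(* [(CoInd_H^G l)(X) = l(res_H^G X)] *)
Section CoIndTambara.
Variables (G : finGroupType) (H : {group G}) (l : Tambara (subg_of H)).
Implicit Types X Y : Gset G.

Definition coindT_gr X : comPzRingType := l (rgset H X).
Definition coindT_res X Y (f : Gmap X Y) :
  {rmorphism coindT_gr Y -> coindT_gr X} := res l (rgmap H f).
Definition coindT_tr X Y (f : Gmap X Y) :
  {additive coindT_gr X -> coindT_gr Y} := tr l (rgmap H f).

Lemma rgmap_id X : rgmap H (gid X) = gid (rgset H X).
Proof. exact: gmap_ext. Qed.

Lemma rgmap_comp X Y Z (f : Gmap Y Z) (g : Gmap X Y) :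
  rgmap H (gcomp f g) = gcomp (rgmap H f) (rgmap H g).
Proof. exact: gmap_ext. Qed.

Lemma coindT_mackey : is_mackey (M := coindT_gr) coindT_res coindT_tr.
Proof.
have [ri rc ti tc pb em co] := green_mackey l.
split=> *; rewrite /coindT_res /coindT_tr.
- by rewrite rgmap_id; apply: ri.
- by rewrite rgmap_comp; apply: rc.
- by rewrite rgmap_id; apply: ti.
- by rewrite rgmap_comp; apply: tc.
- by apply: pb.
- by apply: em.
- by apply: co.
Qed.

Lemma coindT_frobenius X Y (f : Gmap X Y) (a : coindT_gr X) (b : coindT_gr Y) :
  coindT_tr f (a * coindT_res f b) = coindT_tr f a * b.
Proof. exact: frobenius. Qed.

Definition coindT_green : Green G := MkGreen coindT_mackey coindT_frobenius.

Definition coindT_nm X Y (f : Gmap X Y) : coindT_green X -> coindT_green Y :=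
  nm (t := l) (rgmap H f).

Lemma coindT_nm_morph X Y (f : Gmap X Y) : monoid_morphism (coindT_nm f).
Proof. exact: nm_morph. Qed.

Lemma coindT_nm_id X (a : coindT_green X) : coindT_nm (gid X) a = a.
Proof. by rewrite /coindT_nm rgmap_id; apply: nm_id. Qed.

Lemma coindT_nm_comp X Y Z (f : Gmap Y Z) (g : Gmap X Y) (a : coindT_green X) :
  coindT_nm (gcomp f g) a = coindT_nm f (coindT_nm g a).
Proof. by rewrite /coindT_nm rgmap_comp; apply: nm_comp. Qed.

Lemma coindT_nm_pullback X Y Z W (a : Gmap Z X) (b : Gmap Z Y)
    (f : Gmap X W) (g : Gmap Y W) : is_pullback a b f g ->
  forall m : coindT_green X,
    res coindT_green g (coindT_nm f m) = coindT_nm b (res coindT_green a m).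
Proof. by move=> pb m; apply: nm_pullback. Qed.

Lemma coindT_nm_tr X Y A Z E (f : Gmap X Y) (p : Gmap A X) (e : Gmap Z A)
    (f' : Gmap Z E) (q : Gmap E Y) : is_exponential f p e f' q ->
  forall a : coindT_green A,
    coindT_nm f (tr coindT_green p a) =
    tr coindT_green q (coindT_nm f' (res coindT_green e a)).
Proof. by move=> ex a; apply: nm_tr. Qed.

Definition CoIndT : Tambara G :=
  MkTambara coindT_nm_morph coindT_nm_id coindT_nm_comp coindT_nm_pullback
    coindT_nm_tr.
End CoIndTambara.

(** ** The unit of the adjunction *)

Section Counit.
Variables (G : finGroupType) (H : {group G}) (X : Gset G).

Definition counit_fun (O : igset (rgset H X)) : X :=
  gact X (cls_repr O).1 (cls_repr O).2.

Lemma counit_funE (x : rgset H X) g : counit_fun (cls x g) = gact X x g.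
Proof.
rewrite /counit_fun; have /cls_eqP [h [-> ->]] := esym (cls_reprK (cls x g)).
by rewrite /= /rgset_act -actM mulgA mulgV mul1g.
Qed.

Lemma counit_subproof (O : igset (rgset H X)) (g : G) :
  counit_fun (gact (igset (rgset H X)) O g) = gact X (counit_fun O) g.
Proof.
have [x [a ->]] := cls_surj O.
by rewrite igset_actE !counit_funE -actM.
Qed.

(* The counit [(res_H^G X) x_H G -> X, cls x g |-> x . g] of the adjunction
   between induction and restriction of G-sets. *)
Definition gcounit : Gmap (igset (rgset H X)) X := MkGmap counit_subproof.

Lemma gcounitE (x : rgset H X) g : gcounit (cls x g) = gact X x g.
Proof. exact: counit_funE. Qed.
End Counit.
Arguments gcounit {G} H X.

Section Unit.
Variables (G : finGroupType) (H : {group G}) (k : Tambara G).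
Implicit Types X Y : Gset G.

Lemma gcounit_nat X Y (f : Gmap X Y) :
  gcomp (gcounit H Y) (igmap (rgmap H f)) = gcomp f (gcounit H X).
Proof.
apply: gmap_ext => O; have [x [g ->]] := cls_surj O.
by rewrite /= ind_mapE !counit_funE gmapP.
Qed.

Lemma gcounit_pullback X Y (f : Gmap X Y) :
  is_pullback (gcounit H X) (igmap (rgmap H f)) f (gcounit H Y).
Proof.
split=> [O|x O]; first by have := congr1 (fun u => gfun u O) (gcounit_nat f).
have [y [g ->]] := cls_surj O; rewrite gcounitE => e.
have ey : f (gact X x g^-1%g) = y by rewrite gmapP e -actM mulgV act1.
exists (cls (gact X x g^-1%g : rgset H X) g); split.
  by rewrite gcounitE igmapE /= ey -actM mulVg act1.
move=> O1 [e1 /igmap_fibre [x1 eO1 _]]; subst O1.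
by rewrite -e1 gcounitE -actM mulgV act1.
Qed.

Definition unitT_fun X : {rmorphism k X -> CoIndT (ResT H k) X} :=
  res k (gcounit H X).

Lemma unitT_res X Y (f : Gmap X Y) (a : k Y) :
  unitT_fun X (res k f a) = res (CoIndT (ResT H k)) f (unitT_fun Y a).
Proof.
rewrite -[LHS](mk_res_comp (green_mackey k)) -gcounit_nat.
exact: (mk_res_comp (green_mackey k)).
Qed.

Lemma unitT_tr X Y (f : Gmap X Y) (a : k X) :
  unitT_fun Y (tr k f a) = tr (CoIndT (ResT H k)) f (unitT_fun X a).
Proof. exact: (mk_pullback (green_mackey k)) (gcounit_pullback f) a. Qed.

Lemma unitT_nm X Y (f : Gmap X Y) (a : k X) :
  unitT_fun Y (nm f a) = nm (t := CoIndT (ResT H k)) f (unitT_fun X a).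
Proof. exact: nm_pullback (gcounit_pullback f) a. Qed.

(* [k -> CoInd_H^G Res_H^G k] *)
Definition coind_res_unit : TambHom k (CoIndT (ResT H k)) :=
  MkTambHom unitT_res unitT_tr unitT_nm.
End Unit.

(* [coind_res_unit] is indeed the unit of an adjunction between [ResT] and
   [CoIndT]: it is universal among morphisms from [k] to coinduced functors. *)
Section UnitUniversal.
Variables (G : finGroupType) (H : {group G}) (k : Tambara G).
Variables (l : Tambara (subg_of H)) (psi : TambHom k (CoIndT l)).
Implicit Types X Y : Gset (subg_of H).

Lemma gunit_subproof Y (y : Y) (h : subg_of H) :
  cls (gact Y y h) 1%g = gact (rgset H (igset Y)) (cls y 1%g) h.
Proof. by rewrite cls_act /= /rgset_act igset_actE mulg1 mul1g. Qed.

Definition gunit Y : Gmap Y (rgset H (igset Y)) :=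
  @MkGmap _ Y (rgset H (igset Y)) (fun y => cls y 1%g) (@gunit_subproof Y).

Lemma gunit_nat X Y (f : Gmap X Y) :
  gcomp (gunit Y) f = gcomp (rgmap H (igmap f)) (gunit X).
Proof. by apply: gmap_ext => x; rewrite /= ind_mapE. Qed.

Lemma gunit_pullback X Y (f : Gmap X Y) :
  is_pullback (gunit X) f (rgmap H (igmap f)) (gunit Y).
Proof.
split=> [x|O y]; first by rewrite /= ind_mapE.
move=> /igmap_fibre [x -> e]; exists x; split=> // x1 [e1 _].
by apply: (@cls_inj _ _ _ 1%g).
Qed.

Lemma gunitK (X : Gset G) : gcomp (rgmap H (gcounit H X)) (gunit (rgset H X)) = gid _.
Proof. by apply: gmap_ext => x; rewrite /= counit_funE act1. Qed.

Lemma gcounitK Y : gcomp (gcounit H (igset Y)) (igmap (gunit Y)) = gid _.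
Proof.
apply: gmap_ext => O; have [y [g ->]] := cls_surj O.
by rewrite /= ind_mapE counit_funE igset_actE mul1g.
Qed.

Definition transpose_fun Y : {rmorphism ResT H k Y -> l Y} :=
  res l (gunit Y) \o psi (igset Y).

Lemma transpose_res X Y (f : Gmap X Y) a :
  transpose_fun X (res (ResT H k) f a) = res l f (transpose_fun Y a).
Proof.
have rc := mk_res_comp (green_mackey l).
have /= -> := congr1 (res l (gunit X)) (thom_res psi (igmap f) a).
by rewrite -[LHS]rc -gunit_nat; exact: rc.
Qed.

Lemma transpose_tr X Y (f : Gmap X Y) a :
  transpose_fun Y (tr (ResT H k) f a) = tr l f (transpose_fun X a).
Proof.
have /= -> := congr1 (res l (gunit Y)) (thom_tr psi (igmap f) a).
exact: (mk_pullback (green_mackey l)) (gunit_pullback f) _.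
Qed.

Lemma transpose_nm X Y (f : Gmap X Y) (a : ResT H k X) :
  transpose_fun Y (nm f a) = nm f (transpose_fun X a).
Proof.
have /= -> := congr1 (res l (gunit Y)) (thom_nm psi (igmap f) a).
exact: nm_pullback (gunit_pullback f) _.
Qed.

Definition transpose : TambHom (ResT H k) l :=
  MkTambHom transpose_res transpose_tr transpose_nm.

Lemma coind_res_unit_universal :
  exists phi : TambHom (ResT H k) l,
    (forall (X : Gset G) (a : k X),
       phi (rgset H X) (coind_res_unit H k X a) = psi X a) /\
    (forall phi' : TambHom (ResT H k) l,
       (forall (X : Gset G) (a : k X),
          phi' (rgset H X) (coind_res_unit H k X a) = psi X a) ->
       forall Y a, phi' Y a = phi Y a).
Proof.
exists transpose; split=> [X a|phi' phi'E Y a].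
  have /= -> := congr1 (res l (gunit (rgset H X))) (thom_res psi (gcounit H X) a).
  rewrite -[LHS](mk_res_comp (green_mackey l)) gunitK.
  exact: (mk_res_id (green_mackey l)).
rewrite /= -phi'E -(thom_res phi') /=; congr (phi' Y _).
rewrite -[RHS](mk_res_comp (green_mackey k)) gcounitK.
by apply/esym; exact: (mk_res_id (green_mackey k)).
Qed.
End UnitUniversal.

(** * Modules and the relative box product *)

Record GModule (G : finGroupType) (k : Green G) := MkGModule {
  gm :> forall X : Gset G, lmodType (k X);
  mres : forall X Y : Gset G, Gmap X Y -> {additive gm Y -> gm X};
  mtr : forall X Y : Gset G, Gmap X Y -> {additive gm X -> gm Y};
  gm_mackey : is_mackey (M := fun X => gm X : zmodType) mres mtr;
  mres_scale : forall X Y (f : Gmap X Y) (a : k Y) (m : gm Y),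
    mres f (a *: m) = res k f a *: mres f m;
  mtr_scalel : forall X Y (f : Gmap X Y) (a : k X) (m : gm Y),
    mtr f (a *: mres f m) = tr k f a *: m;
  mtr_scaler : forall X Y (f : Gmap X Y) (a : k Y) (m : gm X),
    mtr f (res k f a *: m) = a *: mtr f m }.

Record ModHom (G : finGroupType) (k : Green G) (M N : GModule k) := MkModHom {
  mhom :> forall X : Gset G, {linear M X -> N X};
  mhom_res : forall X Y (f : Gmap X Y) (m : M Y),
    mhom X (mres M f m) = mres N f (mhom Y m);
  mhom_tr : forall X Y (f : Gmap X Y) (m : M X),
    mhom Y (mtr M f m) = mtr N f (mhom X m) }.

(* [k]-bilinear Dress pairings [M, N -> P], that is, morphisms of Mackey
   functors [M box N -> P] that coequalize the two actions of [k] and are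
   [k]-linear. *)
Record Pairing (G : finGroupType) (k : Green G) (M N P : GModule k) :=
  MkPairing {
  pair :> forall X : Gset G, M X -> N X -> P X;
  pairDl : forall X (m m' : M X) (n : N X),
    pair (m + m') n = pair m n + pair m' n;
  pairDr : forall X (m : M X) (n n' : N X),
    pair m (n + n') = pair m n + pair m n';
  pairZl : forall X (a : k X) (m : M X) (n : N X),
    pair (a *: m) n = a *: pair m n;
  pairZr : forall X (a : k X) (m : M X) (n : N X),
    pair m (a *: n) = a *: pair m n;
  pair_res : forall X Y (f : Gmap X Y) (m : M Y) (n : N Y),
    mres P f (pair m n) = pair (mres M f m) (mres N f n);
  pair_trl : forall X Y (f : Gmap X Y) (m : M X) (n : N Y),
    mtr P f (pair m (mres N f n)) = pair (mtr M f m) n;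
  pair_trr : forall X Y (f : Gmap X Y) (m : M Y) (n : N X),
    mtr P f (pair (mres M f m) n) = pair m (mtr N f n) }.

(* [P], with [th : M, N -> P], is [M box_k N]. *)
Definition is_box (G : finGroupType) (k : Green G) (M N P : GModule k)
    (th : Pairing M N P) : Prop :=
  forall (Q : GModule k) (phi : Pairing M N Q),
  exists u : ModHom P Q,
    (forall X m n, u X (th X m n) = phi X m n) /\
    (forall u' : ModHom P Q, (forall X m n, u' X (th X m n) = phi X m n) ->
       forall X p, u' X p = u X p).

Definition short_exact (G : finGroupType) (k : Green G) (A B C : GModule k)
    (f : ModHom A B) (g : ModHom B C) : Prop :=
  [/\ forall X, injective (f X),
      forall X (b : B X), g X b = 0 <-> exists a : A X, f X a = b &
      forall X (c : C X), exists b : B X, g X b = c].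

(* [box_k] is a universal object, hence only defined up to isomorphism, so
   [M box_k -] is exact when the sequences obtained from short exact sequences
   with any choice of box products are.  The first clause asserts that such
   choices exist. *)
Definition flat (G : finGroupType) (k : Green G) (M : GModule k) : Prop :=
  (forall N : GModule k, exists (P : GModule k) (th : Pairing M N P), is_box th)
  /\
  (forall (A B C : GModule k) (f : ModHom A B) (g : ModHom B C),
     short_exact f g ->
   forall (MA MB MC : GModule k) (thA : Pairing M A MA) (thB : Pairing M B MB)
     (thC : Pairing M C MC), is_box thA -> is_box thB -> is_box thC ->
   forall (Mf : ModHom MA MB) (Mg : ModHom MB MC),
     (forall X m a, Mf X (thA X m a) = thB X m (f X a)) ->
     (forall X m b, Mg X (thB X m b) = thC X m (g X b)) ->
   short_exact Mf Mg).

(** * Algebras *)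

Record Alg (G : finGroupType) (k : Tambara G) := MkAlg {
  alg :> Tambara G;
  alg_in : TambHom k alg }.

Record AlgHom (G : finGroupType) (k : Tambara G) (R S : Alg k) := MkAlgHom {
  ahom :> TambHom R S;
  ahom_in : forall X (a : k X), ahom X (alg_in R X a) = alg_in S X a }.

Section AlgModule.
Variables (G : finGroupType) (k : Tambara G) (R : Alg k).

Definition algm_car (X : Gset G) : Type := R X.

Section Level.
Variable X : Gset G.
HB.instance Definition _ := GRing.Zmodule.on (algm_car X).

Definition algm_scale (a : k X) (r : algm_car X) : algm_car X :=
  alg_in R X a * (r : R X).

Lemma algm_scaleA a b r :
  algm_scale a (algm_scale b r) = algm_scale (a * b) r.
Proof. by rewrite /algm_scale rmorphM mulrA. Qed.

Lemma algm_scale1 : left_id 1 algm_scale.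
Proof. by move=> r; rewrite /algm_scale rmorph1 mul1r. Qed.

Lemma algm_scaleDr : right_distributive algm_scale +%R.
Proof. by move=> a r s; rewrite /algm_scale mulrDr. Qed.

Lemma algm_scaleDl r : {morph algm_scale^~ r : a b / a + b}.
Proof. by move=> a b; rewrite /algm_scale rmorphD mulrDl. Qed.

HB.instance Definition _ := GRing.Zmodule_isLmodule.Build (k X) (algm_car X)
  algm_scaleA algm_scale1 algm_scaleDr algm_scaleDl.
End Level.

Definition algm_gm (X : Gset G) : lmodType (k X) := algm_car X.
Definition algm_res (X Y : Gset G) (f : Gmap X Y) :
  {additive algm_gm Y -> algm_gm X} := res R f.
Definition algm_tr (X Y : Gset G) (f : Gmap X Y) :
  {additive algm_gm X -> algm_gm Y} := tr R f.

Lemma algm_mackey : is_mackey (M := fun X => algm_gm X : zmodType) algm_res algm_tr.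
Proof. by case: (green_mackey R) => *; split. Qed.

Lemma algm_res_scale X Y (f : Gmap X Y) (a : k Y) (m : algm_gm Y) :
  algm_res f (a *: m) = res k f a *: algm_res f m.
Proof.
by rewrite /GRing.scale /= /algm_scale (thom_res (alg_in R)) -rmorphM.
Qed.

Lemma algm_tr_scalel X Y (f : Gmap X Y) (a : k X) (m : algm_gm Y) :
  algm_tr f (a *: algm_res f m) = tr k f a *: m.
Proof.
by rewrite /GRing.scale /= /algm_scale (thom_tr (alg_in R)) -frobenius.
Qed.

Lemma algm_tr_scaler X Y (f : Gmap X Y) (a : k Y) (m : algm_gm X) :
  algm_tr f (res k f a *: m) = a *: algm_tr f m.
Proof.
rewrite /GRing.scale /= /algm_scale (thom_res (alg_in R)).
by rewrite mulrC frobenius mulrC.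
Qed.

(* The [k]-module underlying [R]. *)
Definition alg_module : GModule k :=
  MkGModule algm_mackey algm_res_scale algm_tr_scalel algm_tr_scaler.
End AlgModule.

Section AlgPairing.
Variables (G : finGroupType) (k : Tambara G) (R S P : Alg k).
Variables (i1 : AlgHom R P) (i2 : AlgHom S P).
Local Notation M := (alg_module R).
Local Notation N := (alg_module S).
Local Notation Q := (alg_module P).

Definition algp_fun (X : Gset G) (r : M X) (s : N X) : Q X :=
  i1 X r * i2 X s.

Lemma algp_Dl X (r r' : M X) (s : N X) :
  algp_fun (r + r') s = algp_fun r s + algp_fun r' s.
Proof. by rewrite /algp_fun rmorphD mulrDl. Qed.

Lemma algp_Dr X (r : M X) (s s' : N X) :
  algp_fun r (s + s') = algp_fun r s + algp_fun r s'.
Proof. by rewrite /algp_fun rmorphD mulrDr. Qed.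

Lemma algp_Zl X (a : k X) (r : M X) (s : N X) :
  algp_fun (a *: r) s = a *: algp_fun r s.
Proof.
by rewrite /algp_fun /GRing.scale /= /algm_scale rmorphM ahom_in mulrA.
Qed.

Lemma algp_Zr X (a : k X) (r : M X) (s : N X) :
  algp_fun r (a *: s) = a *: algp_fun r s.
Proof.
by rewrite /algp_fun /GRing.scale /= /algm_scale rmorphM ahom_in mulrCA.
Qed.

Lemma algp_res X Y (f : Gmap X Y) (r : M Y) (s : N Y) :
  mres Q f (algp_fun r s) = algp_fun (mres M f r) (mres N f s).
Proof. by rewrite /algp_fun /= rmorphM !thom_res. Qed.

Lemma algp_trl X Y (f : Gmap X Y) (r : M X) (s : N Y) :
  mtr Q f (algp_fun r (mres N f s)) = algp_fun (mtr M f r) s.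
Proof. by rewrite /algp_fun /= thom_res thom_tr frobenius. Qed.

Lemma algp_trr X Y (f : Gmap X Y) (r : M Y) (s : N X) :
  mtr Q f (algp_fun (mres M f r) s) = algp_fun r (mtr N f s).
Proof. by rewrite /algp_fun /= thom_res thom_tr mulrC frobenius mulrC. Qed.

(* [(r, s) |-> i1 r * i2 s] *)
Definition alg_pairing : Pairing M N Q :=
  MkPairing algp_Dl algp_Dr algp_Zl algp_Zr algp_res algp_trl algp_trr.
End AlgPairing.

(* [R box_k R] as a [k]-algebra: its underlying module is the box product, the
   universal pairing being [r (x) s = i1 r * i2 s]; this determines the norms of
   [R box_k R], since [i1] and [i2] preserve them.  [sq_mul] is the
   multiplication [R box_k R -> R]. *)
Record BoxSquare (G : finGroupType) (k : Tambara G) (R : Alg k) :=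
  MkBoxSquare {
  sq :> Alg k;
  sq_in1 : AlgHom R sq;
  sq_in2 : AlgHom R sq;
  sq_box : is_box (alg_pairing sq_in1 sq_in2);
  sq_mul : AlgHom sq R;
  sq_mulE : forall X (r s : R X),
    sq_mul X (sq_in1 X r * sq_in2 X s) = r * s }.

(** * Tambara ideals and Kähler differentials *)

Definition tambara_ideal (G : finGroupType) (R : Tambara G)
    (J : forall X : Gset G, R X -> Prop) : Prop :=
  exists (S : Tambara G) (f : TambHom R S), forall X a, J X a <-> f X a = 0.

Section Orbit.
Variables (G : finGroupType) (H : {group G}).

Definition orb_car : finType := {C : {set G} | C \in rcosets H [set: G]}.

Lemma orb_subproof (C : orb_car) (g : G) :
  (val C :* g)%g \in rcosets H [set: G].
Proof.
case: C => C /= /rcosetsP [x _ ->]; apply/rcosetsP.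
by exists (x * g)%g; rewrite ?inE // rcosetM.
Qed.

Definition orb_act (C : orb_car) (g : G) : orb_car :=
  exist _ (val C :* g)%g (orb_subproof C g).

Lemma orb_act1 C : orb_act C 1%g = C.
Proof. by apply: val_inj; rewrite /= mulg1. Qed.

Lemma orb_actM C : act_morph orb_act C.
Proof. by move=> a b; apply: val_inj; rewrite /= rcosetM. Qed.

(* The transitive G-set [G/H]. *)
Definition orb : Gset G := @MkGset G orb_car (TotalAction orb_act1 orb_actM).
End Orbit.
Arguments orb {G} H.

Definition contains_norms (G : finGroupType) (R : Tambara G)
    (I J : forall X : Gset G, R X -> Prop) : Prop :=
  (forall (H : {group G}) (a b : R (orb H)),
     I (orb H) a -> I (orb H) b -> J (orb H) (a * b)) /\
  (forall (K H : {group G}) (f : Gmap (orb K) (orb H)) (a : R (orb K)),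
     (exists x : G, (K :^ x)%g \proper H) ->
     I (orb K) a -> J (orb H) (nm f a)).

(* [I^{>1}] *)
Definition ideal_gt1 (G : finGroupType) (R : Tambara G)
    (I : forall X : Gset G, R X -> Prop) (X : Gset G) (a : R X) : Prop :=
  forall J, tambara_ideal J -> contains_norms I J -> J X a.

Section Kaehler.
Variables (G : finGroupType) (k : Tambara G) (R : Alg k) (B : BoxSquare R).

Definition diag_ideal (X : Gset G) (a : B X) : Prop := sq_mul B X a = 0.

Section Level.
Variable X : Gset G.

Definition diag_pred : {pred B X} := fun a => sq_mul B X a == 0.

Lemma diag_zmod_closed : zmod_closed diag_pred.
Proof.
split=> [|a b]; first by rewrite unfold_in rmorph0.
by rewrite !unfold_in rmorphB => /eqP-> /eqP->; rewrite subr0.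
Qed.

HB.instance Definition _ := GRing.isZmodClosed.Build (B X) diag_pred
  diag_zmod_closed.

Definition diag_car : Type := {a : B X | a \in diag_pred}.
HB.instance Definition _ := SubChoice.on diag_car.
HB.instance Definition _ := [SubChoice_isSubZmodule of diag_car by <:].

Definition gt1_pred : {pred diag_car} :=
  fun a => `[< ideal_gt1 diag_ideal (val a) >].

Lemma gt1_zmod_closed : zmod_closed gt1_pred.
Proof.
split=> [|a b].
  by apply/asboolP => J [S [f JE]] _; apply/JE; rewrite !raddf0.
move=> /asboolP ha /asboolP hb; apply/asboolP => J JI Jn.
move: (ha J JI Jn) (hb J JI Jn); case: JI => S [f JE].
by move=> /JE fa /JE fb; apply/JE; rewrite !raddfB /= fa fb subr0.
Qed.

HB.instance Definition _ := GRing.isZmodClosed.Build diag_car gt1_pred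
  gt1_zmod_closed.

(* [Omega^{1,Tamb}_{R/k}(X) = I(X) / I^{>1}(X)] *)
Definition kaehler : zmodType := {ideal_quot gt1_pred}.
End Level.
End Kaehler.

(** * Étale morphisms *)

(* As for [flat], the first clause on Kähler differentials asserts that
   [R box_k R] exists. *)
Definition formally_etale (G : finGroupType) (k R : Tambara G)
    (i : TambHom k R) : Prop :=
  let A := MkAlg i in
  [/\ flat (alg_module A),
      inhabited (BoxSquare A) &
      forall (B : BoxSquare A) (X : Gset G) (w : kaehler B X), w = 0].

(* [F], with [x_j \in F(X_j)], is the free polynomial [k]-algebra on
   generators in levels [X_j]: it represents [S |-> \prod_j S(X_j)]. *)
Definition is_free (G : finGroupType) (k : Tambara G) (n : nat)
    (X : 'I_n -> Gset G) (F : Alg k) (x : forall j, F (X j)) : Prop :=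
  forall (S : Alg k) (s : forall j, S (X j)),
  exists u : AlgHom F S,
    (forall j, u (X j) (x j) = s j) /\
    (forall u' : AlgHom F S, (forall j, u' (X j) (x j) = s j) ->
       forall Y a, u' Y a = u Y a).

Definition is_coequalizer (G : finGroupType) (k : Tambara G) (E F R : Alg k)
    (u v : AlgHom E F) (q : AlgHom F R) : Prop :=
  (forall X a, q X (u X a) = q X (v X a)) /\
  (forall (S : Alg k) (t : AlgHom F S),
     (forall X a, t X (u X a) = t X (v X a)) ->
   exists w : AlgHom R S,
     (forall X a, w X (q X a) = t X a) /\
     (forall w' : AlgHom R S, (forall X a, w' X (q X a) = t X a) ->
        forall X a, w' X a = w X a)).

Definition finitely_presented (G : finGroupType) (k : Tambara G) (R : Alg k) :
    Prop :=
  exists (n : nat) (X : 'I_n -> Gset G) (F : Alg k) (x : forall j, F (X j))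
    (m : nat) (Y : 'I_m -> Gset G) (E : Alg k) (y : forall j, E (Y j))
    (u v : AlgHom E F) (q : AlgHom F R),
    [/\ is_free x, is_free y & is_coequalizer u v q].

Definition etale (G : finGroupType) (k R : Tambara G) (i : TambHom k R) : Prop :=
  formally_etale i /\ finitely_presented (MkAlg i).

(* Main.v *)
(* Write [F X = X x_H G], that is [X x G/H], so that [R = CoInd_H^G Res_H^G k]
   is [k(F -)] and [k -> R] is restriction along the projection [F X -> X].
   - [N |-> N(F -)] represents [R box_k -], hence [R] is flat, and
     [R box_k R = k(F F -)].
   - The diagonal of [G/H] gives an idempotent of [R box_k R] whose complement
     [e] generates the kernel [I] of the multiplication.  As [e = e * e] lies in
     [I^{>1}], [I = I^{>1}].
   - [R] is generated by the indicator [delta], in level [G/H], of the diagonal of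
     [G/H x G/H]: every [a] in [R(X)] is the transfer along [F X -> X] of
     [a * delta].  For an element [s] of an algebra [S] in level [G/H],
     [a |-> tr (a * s)] is a morphism [R -> S] as soon as [s] has total transfer
     [1], has orthogonal idempotent conjugates, and satisfies, for each map [f : X -> Y],
     the relation that the norm of [s] along [f] is supported on the constant
     sections of [X x G/H -> X] over [f].  Decomposing into orbits, finitely many
     [f] suffice. *)
From HB Require Import structures.
From mathcomp Require Import all_boot all_fingroup all_algebra.
From mathcomp Require Import ring_quotient generic_quotient.
From mathcomp Require Import boolp.
Require Import Defs.

Set Implicit Arguments.
Unset Strict Implicit.
Unset Printing Implicit Defensive.

Import GRing.Theory.
Local Open Scope ring_scope.
Local Open Scope quotient_scope.

(** * G-sets *)

Lemma gcompE (G : finGroupType) (X Y Z : Gset G) (g : Gmap Y Z) (f : Gmap X Y) x :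
  gcomp g f x = g (f x).
Proof. by []. Qed.

Lemma gmap_funE (G : finGroupType) (X Y : Gset G) (f g : Gmap X Y) x :
  f = g -> f x = g x.
Proof. by move->. Qed.

Section GsetTools.
Variable G : finGroupType.

Definition empty_act (x : void) (g : G) : void := x.
Lemma empty_act1 x : empty_act x 1%g = x. Proof. by []. Qed.
Lemma empty_actM x : act_morph empty_act x. Proof. by []. Qed.
Definition gempty : Gset G := MkGset (TotalAction empty_act1 empty_actM).
Definition gfrom_empty (X : Gset G) : Gmap gempty X :=
  @MkGmap G gempty X (fun x : void => match x with end) (fun x => match x with end).

Definition unit_act (x : unit) (g : G) : unit := x.
Lemma unit_act1 x : unit_act x 1%g = x. Proof. by []. Qed.
Lemma unit_actM x : act_morph unit_act x. Proof. by []. Qed.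
Definition gpt : Gset G := MkGset (TotalAction unit_act1 unit_actM).
Definition to_pt (X : Gset G) : Gmap X gpt :=
  @MkGmap G X gpt (fun=> tt) (fun _ _ => erefl).

Lemma pullback_sym (X Y Z W : Gset G) (a : Gmap Z X) (b : Gmap Z Y)
    (f : Gmap X W) (g : Gmap Y W) :
  is_pullback a b f g -> is_pullback b a g f.
Proof.
move=> [comm univ]; split=> [z|y x /esym/univ]; first by rewrite -comm.
by move=> [z [[<- <-] uz]]; exists z; split=> // z' [eb ea]; apply: uz.
Qed.

Lemma mono_pullback (X Y : Gset G) (f : Gmap X Y) :
  injective f -> is_pullback (gid X) (gid X) f f.
Proof.
move=> inj; split=> // x y /inj ->; exists y; split=> //.
by move=> z [].
Qed.

Lemma iso_pullback (X Y : Gset G) (f : Gmap X Y) (g : Gmap Y X) :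
  gcomp f g = gid Y -> gcomp g f = gid X -> is_pullback g (gid Y) f (gid Y).
Proof.
move=> fg gf; split=> [y|x y /= <-]; first exact: gmap_funE fg.
exists (f x); split; first by split=> //; exact: gmap_funE gf.
by move=> y' [].
Qed.

Lemma coproduct_inj (X Y Z : Gset G) (i : Gmap X Z) (j : Gmap Y Z) :
  is_coproduct i j ->
  [/\ injective i, injective j & forall x y, i x <> j y].
Proof.
move=> /bij_inj inj; split=> [x y e|x y e|x y e].
- by case: (inj (inl x) (inl y) e).
- by case: (inj (inr x) (inr y) e).
- by have := inj (inl x) (inr y) e.
Qed.

Lemma disjoint_pullback (X Y Z : Gset G) (i : Gmap X Z) (j : Gmap Y Z) :
  (forall x y, i x <> j y) ->
  is_pullback (gfrom_empty X) (gfrom_empty Y) i j.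
Proof. by move=> dij; split=> [[]|x y /dij]. Qed.

(** * Mackey functors: injections and disjoint unions *)

Section Mackey.
Variables (M : Gset G -> zmodType).
Variables (rs : forall X Y : Gset G, Gmap X Y -> {additive M Y -> M X}).
Variables (ts : forall X Y : Gset G, Gmap X Y -> {additive M X -> M Y}).
Hypothesis MM : is_mackey rs ts.

Lemma mackey_res_tr_mono X Y (f : Gmap X Y) m :
  injective f -> rs f (ts f m) = m.
Proof.
move/mono_pullback/(mk_pullback MM) => ->.
by rewrite (mk_res_id MM) (mk_tr_id MM).
Qed.

Lemma mackey_res_tr_disjoint X Y Z (i : Gmap X Z) (j : Gmap Y Z) m :
  (forall x y, i x <> j y) -> rs j (ts i m) = 0.
Proof.
move/disjoint_pullback/(mk_pullback MM) => ->.
by rewrite [rs _ m](mk_empty MM) ?raddf0 //; case.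
Qed.

Lemma mackey_coproduct_eq X Y Z (i : Gmap X Z) (j : Gmap Y Z) m n :
  is_coproduct i j -> rs i m = rs i n -> rs j m = rs j n -> m = n.
Proof.
move=> /(mk_coproduct MM)/bij_inj inj ei ej.
by apply: inj; rewrite /= ei ej.
Qed.

(** Equality can be tested after restriction to the two summands, where base change turns one
    transfer into the identity and the other into zero. *)
Lemma mackey_coproduct_tr X Y Z (i : Gmap X Z) (j : Gmap Y Z) m :
  is_coproduct i j -> m = ts i (rs i m) + ts j (rs j m).
Proof.
move=> ij; have [i_inj j_inj dij] := coproduct_inj ij.
have dji y x : j y <> i x by move=> e; apply: (dij x y).
apply: (mackey_coproduct_eq ij); rewrite raddfD mackey_res_tr_mono //.
  by rewrite mackey_res_tr_disjoint // addr0.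
by rewrite mackey_res_tr_disjoint // add0r.
Qed.

End Mackey.
End GsetTools.

Section Constructions.
Variable G : finGroupType.

Lemma gactK (X : Gset G) (x : X) g : gact X (gact X x g) g^-1%g = x.
Proof. by rewrite -actM mulgV act1. Qed.

Lemma gactKV (X : Gset G) (x : X) g : gact X (gact X x g^-1%g) g = x.
Proof. by rewrite -actM mulVg act1. Qed.

Section Product.
Variables X Y : Gset G.
Definition prod_act (p : X * Y) (g : G) : X * Y := (gact X p.1 g, gact Y p.2 g).
Lemma prod_act1 p : prod_act p 1%g = p.
Proof. by case: p => x y; rewrite /prod_act !act1. Qed.
Lemma prod_actM p : act_morph prod_act p.
Proof. by move=> g h; rewrite /prod_act !actM. Qed.
Definition gprod : Gset G := MkGset (TotalAction prod_act1 prod_actM).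
End Product.

Section Power.
Variable X : Gset G.
(** Subsets serve as graphs of sections, which keeps the dependent product below a finite type. *)
Definition pow_act (B : {set X}) (g : G) : {set X} := [set x | gact X x g^-1%g \in B].
Lemma pow_act1 B : pow_act B 1%g = B.
Proof. by apply/setP => x; rewrite inE invg1 act1. Qed.
Lemma pow_actM B : act_morph pow_act B.
Proof. by move=> g h; apply/setP => x; rewrite !inE invMg actM. Qed.
Definition gpow : Gset G := MkGset (TotalAction pow_act1 pow_actM).
End Power.

Section Sub.
Variables (X : Gset G) (P : X -> Prop).
Hypothesis PG : forall x g, P x -> P (gact X x g).
Definition sub_car : finType := {x : X | `[< P x >]}.
Lemma sub_act_subproof (x : sub_car) g : `[< P (gact X (val x) g) >].
Proof. by apply/asboolP/PG/asboolP/(valP x). Qed.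
Definition sub_act (x : sub_car) g : sub_car :=
  exist (fun x => `[< P x >]) _ (sub_act_subproof x g).
Lemma sub_act1 x : sub_act x 1%g = x. Proof. by apply: val_inj; rewrite /= act1. Qed.
Lemma sub_actM x : act_morph sub_act x.
Proof. by move=> g h; apply: val_inj; rewrite /= actM. Qed.
Definition gsub : Gset G := MkGset (TotalAction sub_act1 sub_actM).
Definition gsub_val : Gmap gsub X := @MkGmap G gsub X val (fun _ _ => erefl).
Lemma gsub_inj : injective gsub_val. Proof. exact: val_inj. Qed.
Lemma gsubP (x : gsub) : P (gsub_val x). Proof. by apply/asboolP/(valP x). Qed.
Lemma gsub_ex x : P x -> exists y : gsub, gsub_val y = x.
Proof. by move/asboolP => Px; exists (exist (fun x => `[< P x >]) x Px). Qed.
Definition gsub_mk x (Px : P x) : gsub :=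
  exist (fun x => `[< P x >]) x (introT (asboolP _) Px).
End Sub.

Section Fst.
Variables X Y : Gset G.
Definition gfst : Gmap (gprod X Y) X := @MkGmap G (gprod X Y) X fst (fun _ _ => erefl).
Definition gsnd : Gmap (gprod X Y) Y := @MkGmap G (gprod X Y) Y snd (fun _ _ => erefl).
End Fst.

(** * Existence of exponential diagrams *)

Section Exponential.
Variables (X Y A : Gset G) (f : Gmap X Y) (p : Gmap A X).

(* [B] is the graph of a section of [p] over the fibre of [f] at [y]. *)
Definition is_section (u : gprod Y (gpow A)) : Prop :=
  (forall a, a \in u.2 -> f (p a) = u.1) /\
  (forall x, f x = u.1 -> exists! a, a \in u.2 /\ p a = x).

Lemma is_section_act u g : is_section u -> is_section (gact _ u g).
Proof.
case: u => y B [/= fB secB]; split=> /= [a|x fx].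
  by rewrite inE => /fB; rewrite !gmapP => <-; rewrite gactKV.
have [|a [[aB pa] ua]] := secB (gact X x g^-1%g); first by rewrite gmapP fx gactK.
exists (gact A a g); split.
  by rewrite inE gactK gmapP pa gactKV.
move=> b [/[!inE] bB pb]; apply/esym; rewrite (ua (gact A b g^-1%g)) ?gactKV //.
by split=> //; rewrite gmapP pb.
Qed.

(** The dependent product of [p] along [f]: a point [y] together with a section over its fibre,
    stored as a graph. *)
Definition expE : Gset G := gsub is_section_act.
Definition exp_q : Gmap expE Y := gcomp (gfst Y (gpow A)) (gsub_val is_section_act).
Definition exp_set (t : expE) : {set A} := (val t).2.

Lemma exp_set_act (t : expE) g a :
  (a \in exp_set (gact expE t g)) = (gact A a g^-1%g \in exp_set t).
Proof. by rewrite /exp_set /= inE. Qed.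

Lemma exp_val_subproof (u : gprod A expE) g :
  u.1 \in exp_set u.2 ->
  (gact (gprod A expE) u g).1 \in exp_set (gact (gprod A expE) u g).2.
Proof. by case: u => a t /= at_; rewrite exp_set_act gactK. Qed.

(** A model of the pullback [X x_Y E]: a point of the fibre and the value of the section there
    determine each other, so a section with a point of its graph carries the same data, and
    evaluation becomes a projection. *)
Definition expZ : Gset G := gsub exp_val_subproof.
Definition exp_e : Gmap expZ A := gcomp (gfst A expE) (gsub_val exp_val_subproof).
Definition exp_f : Gmap expZ expE := gcomp (gsnd A expE) (gsub_val exp_val_subproof).

Lemma exp_eP (z : expZ) : exp_e z \in exp_set (exp_f z).
Proof. exact: gsubP z. Qed.

Lemma expZ_inj (z z' : expZ) : exp_e z = exp_e z' -> exp_f z = exp_f z' -> z = z'.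
Proof.
move=> ee ef; apply: val_inj; move: ee ef; rewrite /exp_e /exp_f /=.
by case: (val z) (val z') => [? ?] [? ?] /= -> ->.
Qed.

Lemma expZ_ex (t : expE) a : a \in exp_set t -> exists2 z, exp_e z = a & exp_f z = t.
Proof.
move=> at_; exists (@gsub_mk _ _ exp_val_subproof (a, t) at_) => //.
Qed.

Lemma expE_inj (t t' : expE) : exp_q t = exp_q t' -> exp_set t = exp_set t' -> t = t'.
Proof.
move=> eq es; apply: val_inj; move: eq es; rewrite /exp_q /exp_set /=.
by case: (val t) (val t') => [? ?] [? ?] /= -> ->.
Qed.

Lemma exp_setP (t : expE) a : a \in exp_set t -> f (p a) = exp_q t.
Proof. by have [] := gsubP t => + _; apply. Qed.

Lemma exp_set_uniq (t : expE) x : f x = exp_q t ->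
  exists! a, a \in exp_set t /\ p a = x.
Proof. by have [_] := gsubP t; apply. Qed.

Lemma exp_exponential : is_exponential f p exp_e exp_f exp_q.
Proof.
split.
  split=> [z|x t]; first exact: exp_setP (exp_eP z).
  move/exp_set_uniq => [a [[/expZ_ex [z ez fz] pa] ua]].
  exists z; split=> [|z' [pz' fz']]; first by split; rewrite //= -pa -ez.
  apply: expZ_inj; last by rewrite fz fz'.
  by rewrite ez; apply: ua; split=> //; rewrite -fz'; exact: exp_eP.
(* [B] is the graph of [s]. *)
move=> y s sP; pose B := [set a | [exists x, s x == a]].
have BP a : a \in B -> exists x, s x = a.
  by rewrite inE => /existsP [x /eqP]; exists x.
have sB x : s x \in B by rewrite inE; apply/existsP; exists x.
have sec : is_section (y, B).
  split=> /= [a /BP [x <-]|x /eqP fx]; first by rewrite sP; exact/eqP/(valP x).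
  exists (s (exist _ x fx)); split; first by rewrite sB sP.
  by move=> a [/BP [x' <-]]; rewrite sP => ex; congr s; apply: val_inj.
have sE x h a : x = p a -> a \in B -> a = s (exist _ x h).
  by move=> ex /BP [x' e']; rewrite -e'; congr s; apply: val_inj; rewrite /= ex -e' sP.
exists (gsub_mk is_section_act sec); split.
  split=> // z ez h; apply: sE => //.
  by have := exp_eP z; rewrite ez.
move=> t [qt tP]; apply: expE_inj => //.
have sub a : a \in exp_set t -> a \in B.
  move=> at_; have [z ez fz] := expZ_ex at_.
  have h : f (p (exp_e z)) == y by rewrite ez (exp_setP at_) qt.
  by rewrite -ez (tP z fz h).
(* For the other inclusion, [t] has a point over [p a]; by the first inclusion it is a value of [s],
   hence the same one as [a], since both lie over the same point of [X]. *)
apply/setP => a; apply/idP/idP => [aB|/sub//].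
have [x ex] := BP a aB; have fx : f (p a) = exp_q t.
  by rewrite qt -ex sP; exact/eqP/(valP x).
have [b [[bt pb] _]] := exp_set_uniq fx.
by have [x' ex'] := BP _ (sub _ bt); move: (bt);
  rewrite -ex' (_ : x' = x) ?ex //; apply: val_inj; rewrite -!sP ex ex' pb.
Qed.
End Exponential.

Section Pullback.
Variables (X Y W : Gset G) (f : Gmap X W) (g : Gmap Y W).
Lemma pb_subproof (u : gprod X Y) a :
  f u.1 = g u.2 -> f (gact (gprod X Y) u a).1 = g (gact (gprod X Y) u a).2.
Proof. by rewrite /= !gmapP => ->. Qed.
Definition gpb : Gset G := gsub pb_subproof.
Definition gpb_l : Gmap gpb X := gcomp (gfst X Y) (gsub_val pb_subproof).
Definition gpb_r : Gmap gpb Y := gcomp (gsnd X Y) (gsub_val pb_subproof).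
Lemma gpb_pullback : is_pullback gpb_l gpb_r f g.
Proof.
split=> [z|x y e]; first exact: gsubP z.
exists (@gsub_mk _ _ pb_subproof (x, y) e); split=> // z [ex ey].
apply: val_inj; move: ex ey; rewrite /gpb_l /gpb_r /=.
by case: (val z) => [? ?] /= -> ->.
Qed.
(** For the induction on sizes in [corep_nm]: pulling back along the inclusion of a summand of the
    target does not enlarge the source. *)
Lemma card_gpb : injective g -> (#|gpb| <= #|X|)%N.
Proof.
move=> g_inj; apply: (@leq_card _ _ gpb_l) => z z' e.
apply: val_inj; move: e (gsubP z) (gsubP z'); rewrite /gpb_l /=.
by case: (val z) (val z') => [x y] [x' y'] /= -> -> /g_inj ->.
Qed.
End Pullback.

Lemma pullback_ext (X Y Z W : Gset G) (a : Gmap Z X) (b : Gmap Z Y)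
    (f : Gmap X W) (g : Gmap Y W) (z z' : Z) :
  is_pullback a b f g -> a z = a z' -> b z = b z' -> z = z'.
Proof.
move=> [comm univ] ea eb; have [t [_ ut]] := univ _ _ (comm z).
by rewrite -(ut z) // (ut z').
Qed.

Lemma pullback_paste (X Y Z X' Y' Z' : Gset G) (a : Gmap X X') (b : Gmap Y Y')
    (c : Gmap Z Z') (f : Gmap X Y) (g : Gmap Y Z) (f' : Gmap X' Y') (g' : Gmap Y' Z') :
  is_pullback f a b f' -> is_pullback g b c g' ->
  is_pullback (gcomp g f) a c (gcomp g' f').
Proof.
move=> [e1 u1] [e2 u2]; split=> [x|z x' e]; first by rewrite /= e2 e1.
have [y [[gy by_] uy]] := u2 z (f' x') e.
have [x [[fx ax] ux]] := u1 y x' by_.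
exists x; split; first by rewrite /= fx.
by move=> x1 [/= ez ax1]; apply: ux; split=> //; apply/esym/uy; rewrite e1 ax1.
Qed.

(** An orbit has at most [#|G|] points, so a larger [X] is the disjoint union of an orbit and its
    nonempty complement. Only finitely many isomorphism classes satisfy the bound, which is what
    makes the set of relations finite. *)
Lemma gset_split (X : Gset G) : (#|X| <= #|G|)%N \/
  exists (X1 X2 : Gset G) (i : Gmap X1 X) (j : Gmap X2 X),
    [/\ is_coproduct i j, (#|X1| < #|X|)%N & (#|X2| < #|X|)%N].
Proof.
have [//|big] := leqP #|X| #|G|; first by left.
right; have [x _] : exists x : X, x \in X.
  by apply/card_gt0P; apply: leq_trans big.
pose P y := y \in orbit (gact X) setT x.
have PG y g : P y -> P (gact X y g).
  by rewrite /P => /orbitP [h _ <-]; rewrite -actM mem_orbit.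
have NPG y g : ~ P y -> ~ P (gact X y g).
  by move=> nP /(PG _ g^-1%g); rewrite gactK.
exists (gsub PG), (gsub NPG), (gsub_val PG), (gsub_val NPG).
have [y Ny] : exists y, ~ P y.
  apply: contrapT => all; suff : (#|X| <= #|G|)%N by rewrite leqNgt big.
  rewrite -cardsT -[#|G|]cardsT.
  apply: leq_trans _ (leq_imset_card (gact X x) [set: G]).
  apply/subset_leq_card/subsetP => y _.
  by case: (pselect (P y)) => // Ny; case: all; exists y.
have Px : P x by exact: orbit_refl.
have cop : is_coproduct (gsub_val PG) (gsub_val NPG).
  apply: inj_surj_bij => [[u|u] [v|v] e|z].
  - by rewrite (gsub_inj e).
  - by have := gsubP v; rewrite -e => /(_ (gsubP u)).
  - by have := gsubP u; rewrite e => /(_ (gsubP v)).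
  - by rewrite (gsub_inj e).
  have [Pz|NPz] := pselect (P z).
    by have [u uz] := gsub_ex PG Pz; exists (inl u).
  by have [u uz] := gsub_ex NPG NPz; exists (inr u).
have card_eq : #|X| = (#|gsub PG| + #|gsub NPG|)%N.
  by rewrite -card_sum; exact/esym/(bij_eq_card cop).
have [u _] := gsub_ex PG Px; have [v _] := gsub_ex NPG Ny.
have u_gt0 : (0 < #|gsub PG|)%N by apply/card_gt0P; exists u.
have v_gt0 : (0 < #|gsub NPG|)%N by apply/card_gt0P; exists v.
split=> //; rewrite card_eq.
  by rewrite -[ltnLHS]addn0 ltn_add2l.
by rewrite -[ltnLHS]add0n ltn_add2r.
Qed.
End Constructions.

(** * Modules and box products *)

Section ModHomTools.
Variables (G : finGroupType) (k : Green G).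

Definition mod_id (M : GModule k) : ModHom M M :=
  @MkModHom G k M M (fun X => idfun) (fun _ _ _ _ => erefl) (fun _ _ _ _ => erefl).

Section Comp.
Variables (M N P : GModule k) (v : ModHom N P) (u : ModHom M N).
Lemma mod_comp_res X Y (f : Gmap X Y) (m : M Y) :
  (v X \o u X) (mres M f m) = mres P f ((v Y \o u Y) m).
Proof. by rewrite /= !mhom_res. Qed.
Lemma mod_comp_tr X Y (f : Gmap X Y) (m : M X) :
  (v Y \o u Y) (mtr M f m) = mtr P f ((v X \o u X) m).
Proof. by rewrite /= !mhom_tr. Qed.
Definition mod_comp : ModHom M P :=
  @MkModHom G k M P (fun X => v X \o u X) mod_comp_res mod_comp_tr.
End Comp.

(** Both maps induce the pairing [phi] built from [v] and [th], and the universal property allows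
    only one such map. *)
Lemma box_hom_uniq (M N P : GModule k) (th : Pairing M N P) (Q : GModule k)
    (u v : ModHom P Q) : is_box th ->
  (forall X m n, u X (th X m n) = v X (th X m n)) -> forall X p, u X p = v X p.
Proof.
move=> box uv.
pose phi : Pairing M N Q := @MkPairing G k M N Q (fun X m n => v X (th X m n))
  (fun X m m' n => ltac:(by rewrite /= pairDl linearD))
  (fun X m n n' => ltac:(by rewrite /= pairDr linearD))
  (fun X a m n => ltac:(by rewrite /= pairZl linearZ))
  (fun X a m n => ltac:(by rewrite /= pairZr linearZ))
  (fun X Y f m n => ltac:(by rewrite /= -mhom_res pair_res))
  (fun X Y f m n => ltac:(by rewrite /= -mhom_tr pair_trl))
  (fun X Y f m n => ltac:(by rewrite /= -mhom_tr pair_trr)).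
have [w [_ wU]] := box Q phi.
by move=> X p; rewrite (wU u) // (wU v).
Qed.

Lemma box_iso (M N P P' : GModule k) (th : Pairing M N P) (th' : Pairing M N P') :
  is_box th -> is_box th' ->
  exists (u : ModHom P P') (v : ModHom P' P),
    [/\ forall X m n, u X (th X m n) = th' X m n,
        forall X p, v X (u X p) = p & forall X p, u X (v X p) = p].
Proof.
move=> box box'; have [u [u_th _]] := box _ th'; have [v [v_th _]] := box' _ th.
exists u, v; split=> // X p.
- apply: (@box_hom_uniq _ _ _ th _ (mod_comp v u) (mod_id P)) => // Y m n /=.
  by rewrite u_th v_th.
- apply: (@box_hom_uniq _ _ _ th' _ (mod_comp u v) (mod_id P')) => // Y m n /=.
  by rewrite v_th u_th.
Qed.

(** [flat] quantifies over all choices of box products; this transports exactness from a preferred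
    choice to the others. *)
Lemma short_exact_iso (P Q S P' Q' S' : GModule k)
    (f : ModHom P Q) (g : ModHom Q S) (f' : ModHom P' Q') (g' : ModHom Q' S')
    (a : ModHom P P') (a' : ModHom P' P) (b : ModHom Q Q') (b' : ModHom Q' Q)
    (c : ModHom S S') (c' : ModHom S' S) :
  (forall X, cancel (a X) (a' X)) -> (forall X, cancel (a' X) (a X)) ->
  (forall X, cancel (b X) (b' X)) -> (forall X, cancel (b' X) (b X)) ->
  (forall X, cancel (c X) (c' X)) -> (forall X, cancel (c' X) (c X)) ->
  (forall X p, b X (f X p) = f' X (a X p)) ->
  (forall X q, c X (g X q) = g' X (b X q)) ->
  short_exact f' g' -> short_exact f g.
Proof.
move=> aK Ka bK Kb cK Kc ef eg [inj ex surj]; split=> X.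
- by move=> p q /(congr1 (b X)); rewrite !ef => /inj/(can_inj (aK X)).
- move=> q; split=> [gq0|[p <-]].
    have [] := ex X (b X q); rewrite -eg gq0 linear0 => /(_ erefl) [p ep] _.
    by exists (a' X p); apply: (can_inj (bK X)); rewrite ef Ka.
  apply: (can_inj (cK X)); rewrite eg ef linear0.
  by have [_ ->] := ex X (f' X (a X p)); [|exists (a X p)].
- move=> s; have [q eq] := surj X (c X s).
  by exists (b' X q); apply: (can_inj (cK X)); rewrite eg Kb.
Qed.
End ModHomTools.

Lemma algm_scaleE (G : finGroupType) (k : Tambara G) (R : Alg k) (X : Gset G)
  (a : k X) (r : alg_module R X) : a *: r = alg_in R X a * (r : R X) :> R X.
Proof. by []. Qed.

Definition ahom_comp (G : finGroupType) (k : Tambara G) (P Q S : Alg k)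
  (v : AlgHom Q S) (u : AlgHom P Q) : AlgHom P S.
Proof.
exists (@MkTambHom G P S (fun X => v X \o u X)
  (fun X Y f a => etrans (congr1 (v X) (thom_res u f a)) (thom_res v f _))
  (fun X Y f a => etrans (congr1 (v Y) (thom_tr u f a)) (thom_tr v f _))
  (fun X Y f a => etrans (congr1 (v Y) (thom_nm u f a)) (thom_nm v f _))).
by move=> X a; exact: etrans (congr1 (v X) (ahom_in u a)) (ahom_in v a).
Defined.

(** * Formal etaleness *)

Section Etale.
Variables (G : finGroupType) (H : {group G}) (k : Tambara G).

Local Notation F X := (igset (rgset H X)).
Local Notation Fm f := (igmap (rgmap H f)).
Local Notation eps X := (gcounit H X).

(** With [F X = X x G/H], the maps [eps (F X)] and [Fm (eps X)] are the two projections of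
    [F (F X) = X x G/H x G/H] to [F X], and [diag X] is a common section of them. *)
Definition diag (X : Gset G) : Gmap (F X) (F (F X)) := igmap (gunit (rgset H X)).

Lemma counit_diag X : gcomp (eps (F X)) (diag X) = gid (F X).
Proof. exact: gcounitK. Qed.

Lemma ind_counit_diag X : gcomp (Fm (eps X)) (diag X) = gid (F X).
Proof. by rewrite -igmap_comp gunitK igmap_id. Qed.

Lemma diag_pullback X Y (f : Gmap X Y) :
  is_pullback (diag X) (Fm f) (Fm (Fm f)) (diag Y).
Proof. exact: igmap_pullback (gunit_pullback (rgmap H f)). Qed.

Lemma diag_inj X : injective (diag X).
Proof.
apply: (can_inj (g := eps (F X))) => x; exact: gmap_funE (counit_diag X).
Qed.

Local Notation R := (CoIndT (ResT H k)).
Local Notation A := (MkAlg (coind_res_unit H k)).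
Local Notation M := (alg_module A).

(** * The shifted module [N (F -)] and its pairing *)

Section Mod.
Variable N : GModule k.

Lemma mtr_scale1 X Y (f : Gmap X Y) (n : N Y) :
  tr k f 1 *: n = mtr N f (mres N f n).
Proof. by rewrite -mtr_scalel scale1r. Qed.

Lemma diag_scale X (n : N (F X)) :
  tr k (diag X) 1 *: mres N (eps (F X)) n = mtr N (diag X) n.
Proof.
rewrite mtr_scale1 -(mk_res_comp (gm_mackey N)) counit_diag.
by rewrite (mk_res_id (gm_mackey N)).
Qed.

(** [N (F X)] is already a module over [k (F X)]; the new name lets it carry the [k X]-module
    structure through restriction along [eps X]. *)
Definition shift_car (X : Gset G) : Type := N (F X).

Section Level.
Variable X : Gset G.
HB.instance Definition _ := GRing.Zmodule.on (shift_car X).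

Definition shift_scale (a : k X) (n : shift_car X) : shift_car X :=
  res k (eps X) a *: (n : N (F X)).

Lemma shift_scaleA a b n :
  shift_scale a (shift_scale b n) = shift_scale (a * b) n.
Proof. by rewrite /shift_scale rmorphM scalerA. Qed.

Lemma shift_scale1 : left_id 1 shift_scale.
Proof. by move=> n; rewrite /shift_scale rmorph1 scale1r. Qed.

Lemma shift_scaleDr : right_distributive shift_scale +%R.
Proof. by move=> a m n; rewrite /shift_scale scalerDr. Qed.

Lemma shift_scaleDl n : {morph shift_scale^~ n : a b / a + b}.
Proof. by move=> a b; rewrite /shift_scale rmorphD scalerDl. Qed.

HB.instance Definition _ := GRing.Zmodule_isLmodule.Build (k X) (shift_car X)
  shift_scaleA shift_scale1 shift_scaleDr shift_scaleDl.
End Level.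

Definition shift_gm (X : Gset G) : lmodType (k X) := shift_car X.
Definition shift_res X Y (f : Gmap X Y) : {additive shift_gm Y -> shift_gm X} :=
  mres N (Fm f).
Definition shift_tr X Y (f : Gmap X Y) : {additive shift_gm X -> shift_gm Y} :=
  mtr N (Fm f).

Lemma shift_mackey :
  is_mackey (M := fun X => shift_gm X : zmodType) shift_res shift_tr.
Proof.
have [ri rc ti tc pb em co] := gm_mackey N.
split=> *; rewrite /shift_res /shift_tr /=.
- by rewrite rgmap_id igmap_id; apply: ri.
- by rewrite rgmap_comp igmap_comp; apply: rc.
- by rewrite rgmap_id igmap_id; apply: ti.
- by rewrite rgmap_comp igmap_comp; apply: tc.
- by apply: pb; apply: igmap_pullback.
- by apply: em; apply: igset_empty.
- by apply: co; apply: igmap_coproduct.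
Qed.

Lemma res_counit X Y (f : Gmap X Y) (a : k Y) :
  res k (eps X) (res k f a) = res k (Fm f) (res k (eps Y) a).
Proof. by rewrite -!(mk_res_comp (green_mackey k)) gcounit_nat. Qed.

Lemma mres_counit X Y (f : Gmap X Y) (n : N Y) :
  mres N (eps X) (mres N f n) = mres N (Fm f) (mres N (eps Y) n).
Proof. by rewrite -!(mk_res_comp (gm_mackey N)) gcounit_nat. Qed.

Lemma shift_res_scale X Y (f : Gmap X Y) (a : k Y) (m : shift_gm Y) :
  shift_res f (a *: m) = res k f a *: shift_res f m.
Proof.
rewrite /GRing.scale /= /shift_scale res_counit; exact: mres_scale.
Qed.

Lemma shift_tr_scalel X Y (f : Gmap X Y) (a : k X) (m : shift_gm Y) :
  shift_tr f (a *: shift_res f m) = tr k f a *: m.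
Proof.
rewrite /GRing.scale /= /shift_scale.
rewrite [res k (eps Y) _](mk_pullback (green_mackey k) (gcounit_pullback H f)).
exact: mtr_scalel.
Qed.

Lemma shift_tr_scaler X Y (f : Gmap X Y) (a : k Y) (m : shift_gm X) :
  shift_tr f (res k f a *: m) = a *: shift_tr f m.
Proof.
rewrite /GRing.scale /= /shift_scale res_counit; exact: mtr_scaler.
Qed.

Definition shift : GModule k :=
  MkGModule shift_mackey shift_res_scale shift_tr_scalel shift_tr_scaler.

Definition shift_pair X (a : M X) (n : N X) : shift X :=
  (a : k (F X)) *: mres N (eps X) n.

Lemma shift_pairDl X (a b : M X) (n : N X) :
  shift_pair (a + b) n = shift_pair a n + shift_pair b n.
Proof. exact: (scalerDl (mres N (eps X) n) (a : k (F X)) b). Qed.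

Lemma shift_pairDr X (a : M X) (m n : N X) :
  shift_pair a (m + n) = shift_pair a m + shift_pair a n.
Proof. by rewrite /shift_pair raddfD scalerDr. Qed.

Lemma shift_pairZl X (c : k X) (a : M X) (n : N X) :
  shift_pair (c *: a) n = c *: shift_pair a n.
Proof. by rewrite /shift_pair [RHS]/GRing.scale /= /shift_scale scalerA. Qed.

Lemma shift_pairZr X (c : k X) (a : M X) (n : N X) :
  shift_pair a (c *: n) = c *: shift_pair a n.
Proof.
rewrite /shift_pair [RHS]/GRing.scale /= /shift_scale mres_scale !scalerA.
by rewrite mulrC.
Qed.

Lemma shift_pair_res X Y (f : Gmap X Y) (a : M Y) (n : N Y) :
  mres shift f (shift_pair a n) = shift_pair (mres M f a) (mres N f n).
Proof. 
rewrite /shift_pair mres_counit.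
exact: (mres_scale (Fm f) (a : k (F Y)) (mres N (eps Y) n)).
Qed.

Lemma shift_pair_trl X Y (f : Gmap X Y) (a : M X) (n : N Y) :
  mtr shift f (shift_pair a (mres N f n)) = shift_pair (mtr M f a) n.
Proof. 
rewrite /shift_pair mres_counit.
exact: (mtr_scalel (Fm f) (a : k (F X)) (mres N (eps Y) n)).
Qed.

Lemma shift_pair_trr X Y (f : Gmap X Y) (a : M Y) (n : N X) :
  mtr shift f (shift_pair (mres M f a) n) = shift_pair a (mtr N f n).
Proof.
rewrite /shift_pair (mk_pullback (gm_mackey N) (gcounit_pullback H f)).
exact: (mtr_scaler (Fm f) (a : k (F Y)) (mres N (eps X) n)).
Qed.

Definition shift_pairing : Pairing M N shift :=
  MkPairing shift_pairDl shift_pairDr shift_pairZl shift_pairZr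
    shift_pair_res shift_pair_trl shift_pair_trr.
End Mod.

(* The idempotent of [k(X x G/H x G/H)] supported on the diagonal. *)
Definition delta (X : Gset G) : M (F X) := tr k (diag X) 1.

Lemma delta_res X Y (f : Gmap X Y) : mres M (Fm f) (delta Y) = delta X.
Proof.
rewrite /delta -(rmorph1 (res k (Fm f))).
exact: (mk_pullback (green_mackey k)) (pullback_sym (diag_pullback f)) 1.
Qed.

Lemma scale_delta X (a : k (F X)) : a *: delta X = tr k (diag X) a :> k (F (F X)).
Proof.
rewrite algm_scaleE.
change (res k (eps (F X)) a * tr k (diag X) 1 = tr k (diag X) a).
rewrite mulrC -frobenius mul1r -(mk_res_comp (green_mackey k)) counit_diag.
by rewrite (mk_res_id (green_mackey k)).
Qed.

(** Every element of [R X] is thus a transfer of a multiple of [delta]. The reason is that [diag X]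
    is a section of [Fm (eps X)], along which the transfer is taken. *)
Lemma tr_scale_delta X (a : k (F X)) : mtr M (eps X) (a *: delta X) = a.
Proof.
rewrite scale_delta -[LHS](mk_tr_comp (green_mackey k)) ind_counit_diag.
exact: (mk_tr_id (green_mackey k)).
Qed.

(** * A criterion for recognizing box products with [R] *)

Section BoxCriterion.
Variables (N P : GModule k) (th : Pairing M N P).
Variable e : forall X, P X -> N (F X).
Hypothesis e_zmod : forall X, zmod_morphism (@e X).
Hypothesis e_scale : forall X a p, e (a *: p) = res k (eps X) a *: e p.
Hypothesis e_res : forall X Y (f : Gmap X Y) p, e (mres P f p) = mres N (Fm f) (e p).
Hypothesis e_tr : forall X Y (f : Gmap X Y) p, e (mtr P f p) = mtr N (Fm f) (e p).
Hypothesis e_th : forall X (a : M X) (n : N X),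
  e (th X a n) = (a : k (F X)) *: mres N (eps X) n.
Hypothesis e_inj : forall X, injective (@e X).

(** After applying the injective [e], the right side is [e p] transferred along [diag X] and then
    along [Fm (eps X)], whose composite is the identity. *)
Lemma box_span X (p : P X) : p = mtr P (eps X) (th (F X) (delta X) (e p)).
Proof.
apply: e_inj; rewrite e_tr e_th diag_scale -(mk_tr_comp (gm_mackey N)).
by rewrite ind_counit_diag (mk_tr_id (gm_mackey N)).
Qed.

Section Universal.
Variables (Q : GModule k) (phi : Pairing M N Q).

(** The value that [box_span] forces on any morphism carrying [th] to [phi]. *)
Definition box_map X (p : P X) : Q X :=
  mtr Q (eps X) (phi (F X) (delta X) (e p)).

Lemma box_map_zmod X : zmod_morphism (@box_map X).
Proof.
move=> p q; rewrite /box_map -raddfB; congr (mtr Q _ _).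
by rewrite e_zmod pairDr -[- e q]scaleN1r pairZr scaleN1r.
Qed.

Lemma box_map_scale X : scalable (@box_map X).
Proof. by move=> a p; rewrite /box_map e_scale pairZr mtr_scaler. Qed.

HB.instance Definition _ X :=
  GRing.isZmodMorphism.Build (P X) (Q X) (@box_map X) (@box_map_zmod X).
HB.instance Definition _ X :=
  GRing.isScalable.Build (k X) (P X) (Q X) *:%R (@box_map X) (@box_map_scale X).

Lemma box_map_res X Y (f : Gmap X Y) p :
  box_map (mres P f p) = mres Q f (box_map p).
Proof.
rewrite /box_map (mk_pullback (gm_mackey Q) (pullback_sym (gcounit_pullback H f))).
by rewrite pair_res delta_res e_res.
Qed.

(** By naturality of [eps], the transfer along [f] becomes one along [Fm f]; as [delta X] is
    restricted from [delta Y], the projection formula moves this transfer into the second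
    variable. *)
Lemma box_map_tr X Y (f : Gmap X Y) p :
  box_map (mtr P f p) = mtr Q f (box_map p).
Proof.
rewrite /box_map -(mk_tr_comp (gm_mackey Q)) -gcounit_nat.
by rewrite (mk_tr_comp (gm_mackey Q)) e_tr -(delta_res f) pair_trr.
Qed.

Definition box_hom : ModHom P Q :=
  @MkModHom G k P Q (fun X => @box_map X) box_map_res box_map_tr.

(** Bilinearity moves the scalar [a] to the first variable; the transfer then enters that variable
    by the projection formula, and [tr_scale_delta] returns [a]. *)
Lemma box_hom_th X (a : M X) (n : N X) : box_hom X (th X a n) = phi X a n.
Proof.
rewrite /= /box_map e_th pairZr -pairZl pair_trl; congr (phi X _ _).
exact: tr_scale_delta.
Qed.
End Universal.

Lemma box_criterion : is_box th.
Proof.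
move=> Q phi; exists (box_hom phi); split=> [|u u_th X p]; first exact: box_hom_th.
by rewrite [in LHS](box_span p) mhom_tr u_th.
Qed.
End BoxCriterion.

Lemma shift_box (N : GModule k) : is_box (shift_pairing N).
Proof.
apply: (@box_criterion N (shift N) (shift_pairing N) (fun X n => n)) => // X.
exact: inj_id.
Qed.

Section Hom.
Variables (N P : GModule k) (u : ModHom N P).
Lemma shift_hom_zmod X : zmod_morphism (u (F X) : shift N X -> shift P X).
Proof. by move=> m n; apply: (raddfB (u (F X))). Qed.
Lemma shift_hom_scale X : scalable (u (F X) : shift N X -> shift P X).
Proof. by move=> a n; apply: (linearZZ (u (F X)) (res k (eps X) a)). Qed.
Definition shift_fun X : shift N X -> shift P X := u (F X).
HB.instance Definition _ X :=
  GRing.isZmodMorphism.Build _ _ (@shift_fun X) (@shift_hom_zmod X).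
HB.instance Definition _ X :=
  GRing.isScalable.Build (k X) _ _ *:%R (@shift_fun X) (@shift_hom_scale X).
Definition shift_hom : ModHom (shift N) (shift P) :=
  @MkModHom G k (shift N) (shift P) (fun X => @shift_fun X)
    (fun X Y f => mhom_res u (Fm f)) (fun X Y f => mhom_tr u (Fm f)).
End Hom.

Lemma shift_exact (N P Q : GModule k) (f : ModHom N P) (g : ModHom P Q) :
  short_exact f g -> short_exact (shift_hom f) (shift_hom g).
Proof. by move=> [inj ex surj]; split=> X; [apply: inj|apply: ex|apply: surj]. Qed.

(** The functor [shift] is exact, because exactness is levelwise and [shift] only changes the
    levels. Any other box products are compared with the shifted modules by unique isomorphisms,
    whose naturality is checked on pure pairings. *)
Lemma coind_flat : flat M.
Proof.
split=> [N|N P Q f g ex MN MP MQ thN thP thQ boxN boxP boxQ Mf Mg Mf_th Mg_th].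
  by exists (shift N), (shift_pairing N); exact: shift_box.
have [a [a' [a_th aK Ka]]] := box_iso boxN (shift_box (N := N)).
have [b [b' [b_th bK Kb]]] := box_iso boxP (shift_box (N := P)).
have [c [c' [c_th cK Kc]]] := box_iso boxQ (shift_box (N := Q)).
apply: (short_exact_iso aK Ka bK Kb cK Kc _ _ (shift_exact ex)) => X p.
  apply: (box_hom_uniq (u := mod_comp b Mf) (v := mod_comp (shift_hom f) a) boxN).
  move=> Y m n /=; rewrite Mf_th b_th a_th /= /shift_fun /shift_pair.
  by rewrite linearZ mhom_res.
apply: (box_hom_uniq (u := mod_comp c Mg) (v := mod_comp (shift_hom g) b) boxP).
move=> Y m n /=; rewrite Mg_th c_th b_th /= /shift_fun /shift_pair.
by rewrite linearZ mhom_res.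
Qed.

(** * The box square of [R] *)

Local Notation RR := (CoIndT (ResT H R)).

Definition square_unit_fun X : {rmorphism k X -> RR X} :=
  coind_res_unit H R X \o coind_res_unit H k X.

Lemma square_unit_res X Y (f : Gmap X Y) (a : k Y) :
  square_unit_fun X (res k f a) = res RR f (square_unit_fun Y a).
Proof.
exact: etrans (congr1 (coind_res_unit H R X) (thom_res (coind_res_unit H k) f a))
  (thom_res (coind_res_unit H R) f _).
Qed.

Lemma square_unit_tr X Y (f : Gmap X Y) (a : k X) :
  square_unit_fun Y (tr k f a) = tr RR f (square_unit_fun X a).
Proof.
exact: etrans (congr1 (coind_res_unit H R Y) (thom_tr (coind_res_unit H k) f a))
  (thom_tr (coind_res_unit H R) f _).
Qed.

Lemma square_unit_nm X Y (f : Gmap X Y) (a : k X) :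
  square_unit_fun Y (nm f a) = nm f (square_unit_fun X a).
Proof.
exact: etrans (congr1 (coind_res_unit H R Y) (thom_nm (coind_res_unit H k) f a))
  (thom_nm (coind_res_unit H R) f _).
Qed.

Definition square_alg : Alg k :=
  @MkAlg G k RR (MkTambHom square_unit_res square_unit_tr square_unit_nm).

(** The two inclusions of [R] are restrictions along the two projections [F (F X) -> F X]: here
    [eps (F X)], and for [square_in2] the map [Fm (eps X)], which gives the unit of [R]. *)
Definition square_in1_fun X : {rmorphism R X -> RR X} := res k (eps (F X)).

Definition square_in1_thom : TambHom R RR :=
  @MkTambHom G R RR square_in1_fun
    (fun X Y f => @unitT_res G H k _ _ (Fm f))
    (fun X Y f => @unitT_tr G H k _ _ (Fm f))
    (fun X Y f => @unitT_nm G H k _ _ (Fm f)).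

Lemma square_in1_in X (a : k X) :
  square_in1_thom X (alg_in A X a) = alg_in square_alg X a.
Proof. exact: (res_counit (eps X)). Qed.

Definition square_in1 : AlgHom A square_alg :=
  @MkAlgHom G k A square_alg square_in1_thom square_in1_in.

Definition square_in2 : AlgHom A square_alg :=
  @MkAlgHom G k A square_alg (coind_res_unit H R) (fun X a => erefl).

Definition square_mul_fun X : {rmorphism RR X -> R X} := res k (diag X).

Lemma square_mul_res X Y (f : Gmap X Y) (a : RR Y) :
  square_mul_fun X (res RR f a) = res R f (square_mul_fun Y a).
Proof.
have e : gcomp (Fm (Fm f)) (diag X) = gcomp (diag Y) (Fm f).
  by apply: gmap_ext; exact: (diag_pullback f).1.
rewrite /square_mul_fun.
transitivity (res k (gcomp (Fm (Fm f)) (diag X)) a).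
  exact/esym/(mk_res_comp (green_mackey k)).
rewrite e; exact: (mk_res_comp (green_mackey k)).
Qed.

Lemma square_mul_tr X Y (f : Gmap X Y) (a : RR X) :
  square_mul_fun Y (tr RR f a) = tr R f (square_mul_fun X a).
Proof. exact: (mk_pullback (green_mackey k)) (diag_pullback f) _. Qed.

Lemma square_mul_nm X Y (f : Gmap X Y) (a : RR X) :
  square_mul_fun Y (nm f a) = nm f (square_mul_fun X a).
Proof. exact: nm_pullback (diag_pullback f) _. Qed.

Definition square_mul_thom : TambHom RR R :=
  @MkTambHom G RR R square_mul_fun square_mul_res square_mul_tr square_mul_nm.

Lemma square_mul_in1 X (a : R X) : square_mul_thom X (square_in1 X a) = a.
Proof.
rewrite -[LHS](mk_res_comp (green_mackey k)) counit_diag.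
exact: (mk_res_id (green_mackey k)).
Qed.

Lemma square_mul_in2 X (a : R X) : square_mul_thom X (square_in2 X a) = a.
Proof.
rewrite -[LHS](mk_res_comp (green_mackey k)) ind_counit_diag.
exact: (mk_res_id (green_mackey k)).
Qed.

Lemma square_mul_in X (a : k X) :
  square_mul_thom X (alg_in square_alg X a) = alg_in A X a.
Proof. exact: (square_mul_in2 (alg_in A X a)). Qed.

Definition square_mul : AlgHom square_alg A :=
  @MkAlgHom G k square_alg A square_mul_thom square_mul_in.

Lemma square_mulE X (r s : R X) :
  square_mul X (square_in1 X r * square_in2 X s) = r * s.
Proof.
by rewrite rmorphM; congr (_ * _); [exact: square_mul_in1|exact: square_mul_in2].
Qed.

(** [box_criterion] applies with [e] the identity, since [RR X] is [R (F X)]. The two [k]-actions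
    agree because the two composites [F (F X) -> F X -> X] do. *)
Lemma square_box : is_box (alg_pairing square_in1 square_in2).
Proof.
apply: (@box_criterion M (alg_module square_alg) _ (fun X r => r)) => //.
- move=> X a p.
  rewrite [RHS]algm_scaleE; apply: (etrans (algm_scaleE (R := square_alg) a p)).
  by congr (_ * _); exact: esym (res_counit (eps X) a).
- by move=> X; exact: inj_id.
Qed.

Definition square : BoxSquare A := MkBoxSquare square_box square_mulE.


(** [box_span] for the shifted module passes to any box product along the comparison isomorphism. *)
Lemma box_spanned (N P : GModule k) (th : Pairing M N P) : is_box th ->
  forall X (p : P X), exists n : N (F X), p = mtr P (eps X) (th (F X) (delta X) n).
Proof.
move=> box X p; have [u [v [u_th uK _]]] := box_iso box (shift_box (N := N)).
exists (u X p); rewrite -[LHS]uK -[th _ _ _]uK u_th -mhom_tr.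
congr (v X _); apply: (@box_span N (shift N) (shift_pairing N) (fun X n => n)) => // Y.
exact: inj_id.
Qed.

Lemma delta_mul X (a : R (F X)) :
  (delta X : R (F X)) * a = tr k (diag X) (res k (diag X) a).
Proof.
change (tr k (diag X) 1 * (a : k (F (F X))) = tr k (diag X) (res k (diag X) a)).
by rewrite -frobenius mul1r.
Qed.

(** The two projections agree on the diagonal, so next to [delta] a restriction along one may be
    replaced by a restriction along the other, that is, by a scalar from [k (F X)]. *)
Lemma delta_mul_res X (r : R X) :
  (delta X : R (F X)) * res R (eps X) r = (r : k (F X)) *: delta X :> R (F X).
Proof.
rewrite delta_mul scale_delta; congr (tr k _ _).
exact: square_mul_in2.
Qed.

Lemma delta_idem X : (delta X : R (F X)) * delta X = delta X :> R (F X).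
Proof.
rewrite delta_mul; congr (tr k (diag X) _).
exact: (mackey_res_tr_mono (green_mackey k) 1 (@diag_inj X)).
Qed.

Lemma tr_delta X : tr R (eps X) (delta X) = 1.
Proof. by rewrite -[RHS]tr_scale_delta scale1r. Qed.

Lemma top_coset_subproof : [set: G] \in rcosets [set: G]%G [set: G].
Proof. by apply/rcosetsP; exists 1%g; rewrite ?mulg1. Qed.

Definition top_coset : orb_car [set: G]%G :=
  exist (fun C : {set G} => C \in rcosets [set: G] [set: G]) _ top_coset_subproof.

Lemma to_top_subproof (X : Gset G) (x : X) (g : G) :
  top_coset = gact (orb [set: G]%G) top_coset g.
Proof. by apply: val_inj; rewrite /= rcoset_id ?inE. Qed.

(** [contains_norms] speaks of orbits, so the final G-set is taken here in the form [G/G]. *)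
Definition to_top (X : Gset G) : Gmap X (orb [set: G]%G) :=
  @MkGmap G X (orb [set: G]%G) (fun=> top_coset) (@to_top_subproof X).

(** * The diagonal idempotent and the vanishing of differentials *)

Section AnySquare.
Variable B : BoxSquare A.
Local Notation i1 := (sq_in1 B).
Local Notation i2 := (sq_in2 B).

Definition sq_delta X : B (F X) := i1 (F X) (delta X) * i2 (F X) (delta X).

(* The idempotent of [B] supported on the diagonal. *)
Definition sq_diag X : B X := tr B (eps X) (sq_delta X).

Lemma sq_delta_res X Y (f : Gmap X Y) : res B (Fm f) (sq_delta Y) = sq_delta X.
Proof.
rewrite rmorphM -!thom_res; congr (i1 _ _ * i2 _ _); exact: (delta_res f).
Qed.

Lemma sq_diag_res X Y (f : Gmap X Y) : res B f (sq_diag Y) = sq_diag X.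
Proof.
rewrite /sq_diag -(sq_delta_res f).
exact: (mk_pullback (green_mackey B) (pullback_sym (gcounit_pullback H f))).
Qed.

Lemma sq_mul_diag X : sq_mul B X (sq_diag X) = 1.
Proof. by rewrite thom_tr sq_mulE delta_idem tr_delta. Qed.

(** Multiplication by [delta] turns the restrictions of [r] and [s] into scalars from [k (F X)].
    Scalars pass freely between the two factors, so only the product [r * s] matters. *)
Lemma sq_diag_pure X (r s : R X) :
  r * s = 0 -> sq_diag X * (i1 X r * i2 X s) = 0.
Proof.
move=> rs0; rewrite -frobenius rmorphM -!thom_res mulrACA -!rmorphM.
rewrite !delta_mul_res !algm_scaleE !rmorphM !ahom_in mulrACA -rmorphM.
rewrite -[X in alg_in B _ X]/((r : R X) * (s : R X)) rs0 rmorph0 mul0r raddf0.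
by [].
Qed.

Lemma sq_diag_ker X (b : B X) : sq_mul B X b = 0 -> sq_diag X * b = 0.
Proof.
have [q ->] := box_spanned (@sq_box _ _ _ B) b => mb0.
(* [delta * q] is a multiple of [delta], and its transfer is the coefficient. That transfer is the
   image of [b] under multiplication, so it vanishes. *)
have {mb0} dq0 : (delta X : R (F X)) * q = 0.
  move: mb0; rewrite [mtr _ _ _]/= thom_tr sq_mulE delta_mul -scale_delta.
  by rewrite [tr _ _ _]tr_scale_delta => ->; rewrite scale_delta raddf0.
rewrite [LHS]mulrC -[LHS]frobenius sq_diag_res mulrC.
by rewrite sq_diag_pure // raddf0.
Qed.

Lemma diag_ideal_gt1 X (a : B X) : diag_ideal a -> ideal_gt1 (@diag_ideal _ _ _ B) a.
Proof.
move=> Ia J [S [f JE]] [JM _]; pose T := orb [set: G]%G; pose e := 1 - sq_diag T.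
have Ie : diag_ideal e by rewrite /diag_ideal rmorphB rmorph1 sq_mul_diag subrr.
have ee : e * e = e.
  by rewrite {1}/e mulrBl mul1r sq_diag_ker ?subr0.
have /JE fe : J _ e by rewrite -ee; exact: JM.
(* Since the diagonal idempotent kills [a], the restriction of its complement [e] fixes [a]. *)
apply/JE; have -> : a = a * res B (to_top X) e.
  rewrite rmorphB rmorph1 sq_diag_res mulrBr mulr1 [a * sq_diag X]mulrC.
  by rewrite sq_diag_ker ?subr0.
by rewrite rmorphM thom_res fe rmorph0 mulr0.
Qed.

Lemma kaehler0 X (w : kaehler B X) : w = 0.
Proof.
rewrite -[w]reprK -[0]reprK; apply/eqP; rewrite -Quotient.idealrBE.
apply/asboolP; apply: diag_ideal_gt1; exact/eqP/(valP (repr w - repr 0)).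
Qed.
End AnySquare.

Lemma coind_formally_etale : formally_etale (coind_res_unit H k).
Proof.
split; [exact: coind_flat | exact: inhabits square | exact: kaehler0].
Qed.

End Etale.

(** * Free algebras *)

Section Small.
Variable G : finGroupType.

Definition small_act_ax n (a : {ffun 'I_n * G -> 'I_n}) : bool :=
  [forall i, a (i, 1%g) == i] &&
  [forall i, [forall g, [forall h, a (i, (g * h)%g) == a (a (i, g), h)]]].

(** An action is stored as a finite table with a boolean axiom; this also makes the actions on a
    fixed ['I_n] a finite type, as [bounded] requires. *)
Definition small : Type :=
  {n : nat & {a : {ffun 'I_n * G -> 'I_n} | small_act_ax a}}.

Section Gset_of_small.
Variables (n : nat) (a : {a : {ffun 'I_n * G -> 'I_n} | small_act_ax a}).
Definition small_act (i : 'I_n) (g : G) : 'I_n := val a (i, g).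

Lemma small_act1 i : small_act i 1%g = i.
Proof. by have /andP[/forallP/(_ i)/eqP] := valP a. Qed.

Lemma small_actM i : act_morph small_act i.
Proof.
move=> g h.
by have /andP[_ /forallP/(_ i)/forallP/(_ g)/forallP/(_ h)/eqP] := valP a.
Qed.

Definition gset_of_small : Gset G := MkGset (TotalAction small_act1 small_actM).
End Gset_of_small.

Definition sg (s : small) : Gset G := gset_of_small (projT2 s).

Section Skeleton.
Variable X : Gset G.

Definition sk_act : {ffun 'I_#|X| * G -> 'I_#|X|} :=
  [ffun p => enum_rank (gact X (enum_val p.1) p.2)].

Lemma sk_act_ax : small_act_ax sk_act.
Proof.
apply/andP; split; first by apply/forallP => i; rewrite ffunE /= act1 enum_valK.
apply/forallP => i; apply/forallP => g; apply/forallP => h.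
by rewrite !ffunE /= enum_rankK actM.
Qed.

Definition sk : small := existT _ #|X| (exist _ sk_act sk_act_ax).

Lemma to_sk_subproof (x : X) (g : G) :
  (enum_rank (gact X x g) : sg sk) = gact (sg sk) (enum_rank x : sg sk) g.
Proof. by rewrite /= /small_act ffunE /= enum_rankK. Qed.

Definition to_sk : Gmap X (sg sk) := @MkGmap _ X (sg sk) _ to_sk_subproof.

Lemma of_sk_subproof (i : sg sk) (g : G) :
  (enum_val (gact (sg sk) i g : 'I_#|X|)) = gact X (enum_val (i : 'I_#|X|)) g.
Proof. by rewrite /= /small_act ffunE /= enum_rankK. Qed.

Definition of_sk : Gmap (sg sk) X := @MkGmap _ (sg sk) X _ of_sk_subproof.

Lemma to_skK : gcomp of_sk to_sk = gid X.
Proof. by apply: gmap_ext => x /=; rewrite enum_rankK. Qed.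

Lemma of_skK : gcomp to_sk of_sk = gid (sg sk).
Proof. by apply: gmap_ext => x /=; rewrite enum_valK. Qed.
End Skeleton.

Definition sk_map (X Y : Gset G) (f : Gmap X Y) : Gmap (sg (sk X)) (sg (sk Y)) :=
  gcomp (to_sk Y) (gcomp f (of_sk X)).

Lemma sk_mapE (X Y : Gset G) (f : Gmap X Y) :
  gcomp (sk_map f) (to_sk X) = gcomp (to_sk Y) f.
Proof. by apply: gmap_ext => x /=; rewrite enum_rankK. Qed.
End Small.

(** * The algebra of Tambara terms *)

Section Free.
Variables (G : finGroupType) (k : Tambara G) (J : Type) (V : J -> Gset G).

(* Terms are indexed by the G-sets with carrier some ['I_n]: quantifying over all
   G-sets would put them in a universe too large for the carrier of a ring. *)
Inductive term : small G -> Type :=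
| Cst x of k (sg x) : term x
| Var j : term (sk (V j))
| Add x of term x & term x : term x
| Opp x of term x : term x
| Mul x of term x & term x : term x
| Res x y of Gmap (sg x) (sg y) & term y : term x
| Tr x y of Gmap (sg x) (sg y) & term x : term y
| Nm x y of Gmap (sg x) (sg y) & term x : term y.

Section Eval.
Variables (S : Alg k) (s : forall j, S (V j)).

Fixpoint eval x (t : term x) : S (sg x) :=
  match t in term x return S (sg x) with
  | Cst x a => alg_in S (sg x) a
  | Var j => res S (of_sk (V j)) (s j)
  | Add x t u => eval t + eval u
  | Opp x t => - eval t
  | Mul x t u => eval t * eval u
  | Res x y f t => res S f (eval t)
  | Tr x y f t => tr S f (eval t)
  | Nm x y f t => nm f (eval t)
  end.
End Eval.

(* Identifying the terms that agree under all evaluations, the quotient inherits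
   every equational law of Tambara functors from the algebras [S]. *)
Definition term_equiv x (t u : term x) : bool :=
  `[< forall (S : Alg k) (s : forall j, S (V j)), eval s t = eval s u >].

Definition poly_term (X : Gset G) : Type := term (sk X).
Section Level.
Variable X : Gset G.
HB.instance Definition _ := gen_eqMixin (poly_term X).
HB.instance Definition _ := gen_choiceMixin (poly_term X).

Lemma term_equiv_class : equiv_class_of (fun t u : poly_term X => term_equiv t u).
Proof.
split=> [t|t u|t u v].
- exact/asboolP.
- by apply/asboolP/asboolP => e S s.
- by move=> /asboolP e1 /asboolP e2; apply/asboolP => S s; rewrite e1.
Qed.

Canonical term_equiv_rel := EquivRelPack term_equiv_class.
Definition polyT : Type := {eq_quot term_equiv_rel}.
HB.instance Definition _ := Choice.on polyT.
Definition qcls (t : poly_term X) : polyT := \pi_polyT t.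


Section EvalQuot.
Variables (S : Alg k) (s : forall j, S (V j)).
Definition evalX (t : poly_term X) : S X := res S (to_sk X) (eval s t).
Definition evalq (q : polyT) : S X := evalX (repr q).
Lemma evalX_pi (t : poly_term X) : evalq (qcls t) = evalX t.
Proof.
rewrite /evalq /evalX; congr (res _ _ _).
have e : repr (qcls t) = t %[mod polyT] by rewrite /qcls reprK.
by move/eqmodP/asboolP: e; apply.
Qed.
End EvalQuot.

(** Evaluations are jointly injective because [term_equiv] is agreement under all of them and
    [to_sk X] is an isomorphism. Every law of the term algebra is checked through this. *)
Lemma evalq_inj (p q : polyT) :
  (forall (S : Alg k) (s : forall j, S (V j)), evalq s p = evalq s q) -> p = q.
Proof.
move=> e; rewrite -[p]reprK -[q]reprK; apply/eqmodP/asboolP => S s.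
have rc := mk_res_comp (green_mackey S).
rewrite -[LHS](mk_res_id (green_mackey S)) -[RHS](mk_res_id (green_mackey S)).
by rewrite -of_skK !rc; have := congr1 (res S (of_sk X)) (e S s).
Qed.

Definition qadd (p q : polyT) : polyT := qcls (Add (repr p) (repr q)).
Definition qopp (p : polyT) : polyT := qcls (Opp (repr p)).
Definition qmul (p q : polyT) : polyT := qcls (Mul (repr p) (repr q)).
Definition qcst (a : k X) : polyT := qcls (Cst (res k (of_sk X) a)).

Section EvalOps.
Variables (S : Alg k) (s : forall j, S (V j)).
Lemma evalq_add p q : evalq s (qadd p q) = evalq s p + evalq s q.
Proof. by rewrite evalX_pi /evalX /= rmorphD. Qed.
Lemma evalq_opp p : evalq s (qopp p) = - evalq s p.
Proof. by rewrite evalX_pi /evalX /= rmorphN. Qed.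
Lemma evalq_mul p q : evalq s (qmul p q) = evalq s p * evalq s q.
Proof. by rewrite evalX_pi /evalX /= rmorphM. Qed.
Lemma evalq_cst a : evalq s (qcst a) = alg_in S X a.
Proof.
rewrite evalX_pi /evalX /= -thom_res -(mk_res_comp (green_mackey k)) to_skK.
by rewrite (mk_res_id (green_mackey k)).
Qed.
End EvalOps.

Local Ltac by_eval := move=> *; apply: evalq_inj => S s;
  rewrite ?(evalq_add, evalq_opp, evalq_mul, evalq_cst).

Lemma qaddA : associative qadd. Proof. by by_eval; rewrite addrA. Qed.
Lemma qaddC : commutative qadd. Proof. by by_eval; rewrite addrC. Qed.
Lemma qadd0 : left_id (qcst 0) qadd.
Proof. by by_eval; rewrite rmorph0 add0r. Qed.
Lemma qaddN : left_inverse (qcst 0) qopp qadd.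
Proof. by by_eval; rewrite rmorph0 addNr. Qed.
Lemma qmulA : associative qmul. Proof. by by_eval; rewrite mulrA. Qed.
Lemma qmulC : commutative qmul. Proof. by by_eval; rewrite mulrC. Qed.
Lemma qmul1 : left_id (qcst 1) qmul.
Proof. by by_eval; rewrite rmorph1 mul1r. Qed.
Lemma qmulDl : left_distributive qmul qadd.
Proof. by by_eval; rewrite mulrDl. Qed.

HB.instance Definition _ := GRing.isZmodule.Build polyT qaddA qaddC qadd0 qaddN.
HB.instance Definition _ := GRing.Zmodule_isComPzRing.Build polyT
  qmulA qmulC qmul1 qmulDl.

Section EvalMorph.
Variables (S : Alg k) (s : forall j, S (V j)).
Lemma evalq_zmod : zmod_morphism (evalq s).
Proof. by move=> p q; rewrite evalq_add evalq_opp. Qed.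
Lemma evalq_monoid : monoid_morphism (evalq s).
Proof. by split=> [|p q]; rewrite ?evalq_cst ?rmorph1 ?evalq_mul. Qed.
HB.instance Definition _ :=
  GRing.isZmodMorphism.Build polyT (S X) (evalq s) evalq_zmod.
HB.instance Definition _ :=
  GRing.isMonoidMorphism.Build polyT (S X) (evalq s) evalq_monoid.
Definition evalR : {rmorphism polyT -> S X} := evalq s.
End EvalMorph.
End Level.

Definition free_gr (X : Gset G) : comPzRingType := polyT X.

Lemma evalR_inj X (p q : free_gr X) :
  (forall (S : Alg k) (s : forall j, S (V j)), evalR X s p = evalR X s q) -> p = q.
Proof. exact: evalq_inj. Qed.

Section Ops.
Variables (X Y : Gset G) (f : Gmap X Y).
Definition qres (q : free_gr Y) : free_gr X := qcls (Res (sk_map f) (repr q)).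
Definition qtr (q : free_gr X) : free_gr Y := qcls (Tr (sk_map f) (repr q)).
Definition qnm (q : free_gr X) : free_gr Y := qcls (Nm (sk_map f) (repr q)).
Variables (S : Alg k) (s : forall j, S (V j)).
Lemma evalq_res q : evalR X s (qres q) = res S f (evalR Y s q).
Proof.
rewrite [LHS]evalX_pi /evalX /=.
by rewrite -[LHS](mk_res_comp (green_mackey S)) sk_mapE (mk_res_comp (green_mackey S)).
Qed.
(** The naturality square of an isomorphism is a pullback, so transfers and norms are compatible
    with passing to the skeleton. *)
Lemma sk_map_pullback : is_pullback (to_sk X) f (sk_map f) (to_sk Y).
Proof.
split=> [x|i y e]; first exact: gmap_funE (sk_mapE f).
exists (of_sk X i); split; first split.
- exact: gmap_funE (of_skK X).
- move/(congr1 (of_sk Y)): e.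
  have /= h := gmap_funE _ (to_skK Y); rewrite [RHS]h.
  by rewrite /sk_map /= enum_rankK.
- move=> x [<- _]; exact: gmap_funE (to_skK X).
Qed.
Lemma evalq_tr q : evalR Y s (qtr q) = tr S f (evalR X s q).
Proof.
rewrite [LHS]evalX_pi /evalX /=.
exact: (mk_pullback (green_mackey S)) sk_map_pullback _.
Qed.
Lemma evalq_nm q : evalR Y s (qnm q) = nm f (evalR X s q).
Proof. rewrite [LHS]evalX_pi /evalX /=; exact: nm_pullback sk_map_pullback _. Qed.
End Ops.

Section OpsMorph.
Variables (X Y : Gset G) (f : Gmap X Y).
Lemma qres_zmod : zmod_morphism (qres f).
Proof. by move=> p q; apply: evalR_inj => S s; rewrite rmorphB !evalq_res !rmorphB. Qed.
Lemma qres_monoid : monoid_morphism (qres f).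
Proof.
by split=> [|p q]; apply: evalR_inj => S s;
  rewrite ?(evalq_res, rmorph1, rmorphM).
Qed.
HB.instance Definition _ := GRing.isZmodMorphism.Build _ _ (qres f) qres_zmod.
HB.instance Definition _ := GRing.isMonoidMorphism.Build _ _ (qres f) qres_monoid.
Lemma qtr_zmod : zmod_morphism (qtr f).
Proof.
by move=> p q; apply: evalR_inj => S s; rewrite rmorphB !evalq_tr rmorphB raddfB.
Qed.
HB.instance Definition _ := GRing.isZmodMorphism.Build _ _ (qtr f) qtr_zmod.
Definition free_res : {rmorphism free_gr Y -> free_gr X} := qres f.
Definition free_tr : {additive free_gr X -> free_gr Y} := qtr f.
End OpsMorph.

Section Eval.
Variables (X Y : Gset G) (f : Gmap X Y) (S : Alg k) (s : forall j, S (V j)).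
Lemma eval_res q : evalR X s (free_res f q) = res S f (evalR Y s q).
Proof. exact: evalq_res. Qed.
Lemma eval_tr q : evalR Y s (free_tr f q) = tr S f (evalR X s q).
Proof. exact: evalq_tr. Qed.
End Eval.

(** Bijectivity is not an equational law, but it becomes one once the inverse is written as a sum of
    two transfers. *)
Lemma free_coproduct X Y Z (i : Gmap X Z) (j : Gmap Y Z) :
  is_coproduct i j ->
  bijective (fun m : free_gr Z => (free_res i m, free_res j m)).
Proof.
have M (S : Alg k) := green_mackey S.
move=> ij; have [i_inj j_inj dij] := coproduct_inj ij.
have dji y x : j y <> i x by move=> e; apply: (dij x y).
exists (fun p => free_tr i p.1 + free_tr j p.2) => [q|[p q]] /=.
  apply: evalR_inj => S s.
  by rewrite rmorphD !eval_tr !eval_res -(mackey_coproduct_tr (M S) _ ij).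
congr (_, _); apply: evalR_inj => S s; rewrite eval_res rmorphD !eval_tr raddfD /=.
  rewrite (mackey_res_tr_mono (M S)) // (mackey_res_tr_disjoint (M S)) //.
  by rewrite addr0.
rewrite addrC (mackey_res_tr_mono (M S)) // (mackey_res_tr_disjoint (M S)) //.
by rewrite addr0.
Qed.

Lemma free_mackey : is_mackey (M := free_gr) free_res free_tr.
Proof.
have M (S : Alg k) := green_mackey S.
split=> *; try by [apply: evalR_inj => S s; rewrite !(eval_res, eval_tr);
  apply: (mk_res_id (M S)) || apply: (mk_res_comp (M S)) ||
  apply: (mk_tr_id (M S)) || apply: (mk_tr_comp (M S)) ||
  apply: (mk_pullback (M S))].
- by apply: evalR_inj => S s; rewrite rmorph0; apply: (mk_empty (M S)).
- exact: free_coproduct.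
Qed.

Lemma free_frobenius X Y (f : Gmap X Y) (a : free_gr X) (b : free_gr Y) :
  free_tr f (a * free_res f b) = free_tr f a * b.
Proof.
apply: evalR_inj => S s.
by rewrite !(rmorphM, eval_res, eval_tr) frobenius.
Qed.

Definition free_green : Green G := MkGreen free_mackey free_frobenius.

Definition free_nm X Y (f : Gmap X Y) (q : free_green X) : free_green Y := qnm f q.

Lemma eval_nm X Y (f : Gmap X Y) (S : Alg k) (s : forall j, S (V j)) q :
  evalR Y s (free_nm f q) = nm f (evalR X s q).
Proof. exact: evalq_nm. Qed.

Lemma free_nm_morph X Y (f : Gmap X Y) : monoid_morphism (free_nm f).
Proof.
split=> [|p q]; apply: evalR_inj => S s; rewrite !(eval_nm, rmorph1, rmorphM);
  have [nm1 nmM] := @nm_morph G S X Y f; [exact: nm1 | exact: nmM].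
Qed.

Lemma free_nm_id X (a : free_green X) : free_nm (gid X) a = a.
Proof. by apply: evalR_inj => S s; rewrite eval_nm nm_id. Qed.

Lemma free_nm_comp X Y Z (f : Gmap Y Z) (g : Gmap X Y) (a : free_green X) :
  free_nm (gcomp f g) a = free_nm f (free_nm g a).
Proof. by apply: evalR_inj => S s; rewrite !eval_nm nm_comp. Qed.

Lemma free_nm_pullback X Y Z W (a : Gmap Z X) (b : Gmap Z Y)
    (f : Gmap X W) (g : Gmap Y W) : is_pullback a b f g ->
  forall m : free_green X,
    res free_green g (free_nm f m) = free_nm b (res free_green a m).
Proof.
move=> pb m; apply: evalR_inj => S s.
by rewrite eval_res !eval_nm eval_res; apply: nm_pullback.
Qed.

Lemma free_nm_tr X Y A Z E (f : Gmap X Y) (p : Gmap A X) (e : Gmap Z A)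
    (f' : Gmap Z E) (q : Gmap E Y) : is_exponential f p e f' q ->
  forall a : free_green A,
    free_nm f (tr free_green p a) =
    tr free_green q (free_nm f' (res free_green e a)).
Proof.
move=> ex a; apply: evalR_inj => S s.
by rewrite eval_nm !eval_tr eval_nm eval_res; apply: nm_tr.
Qed.

Definition free_tambara : Tambara G :=
  MkTambara free_nm_morph free_nm_id free_nm_comp free_nm_pullback free_nm_tr.


Lemma free_cst_zmod X : zmod_morphism (@qcst X : k X -> free_gr X).
Proof.
by move=> a b; apply: evalR_inj => S s; rewrite rmorphB ![evalR _ _ _]evalq_cst rmorphB.
Qed.
Lemma free_cst_monoid X : monoid_morphism (@qcst X : k X -> free_gr X).
Proof.
split=> // a b; apply: evalR_inj => S s.
by rewrite rmorphM ![evalR _ _ _]evalq_cst rmorphM.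
Qed.
HB.instance Definition _ X := GRing.isZmodMorphism.Build _ _ _ (@free_cst_zmod X).
HB.instance Definition _ X := GRing.isMonoidMorphism.Build _ _ _ (@free_cst_monoid X).
Definition free_cst X : {rmorphism k X -> free_tambara X} := (@qcst X : k X -> free_gr X).

Lemma eval_cst X (S : Alg k) (s : forall j, S (V j)) (a : k X) :
  evalR X s (free_cst X a) = alg_in S X a.
Proof. exact: evalq_cst. Qed.

Lemma free_cst_res X Y (f : Gmap X Y) (a : k Y) :
  free_cst X (res k f a) = res free_tambara f (free_cst Y a).
Proof.
by apply: evalR_inj => S s; rewrite eval_res !eval_cst thom_res.
Qed.

Lemma free_cst_tr X Y (f : Gmap X Y) (a : k X) :
  free_cst Y (tr k f a) = tr free_tambara f (free_cst X a).
Proof.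
by apply: evalR_inj => S s; rewrite eval_tr !eval_cst thom_tr.
Qed.

Lemma free_cst_nm X Y (f : Gmap X Y) (a : k X) :
  free_cst Y (nm f a) = nm f (free_cst X a).
Proof.
by apply: evalR_inj => S s; rewrite eval_nm !eval_cst thom_nm.
Qed.

Definition free_alg : Alg k := MkAlg (MkTambHom free_cst_res free_cst_tr free_cst_nm).

Section EvalHom.
Variables (S : Alg k) (s : forall j, S (V j)).
Definition eval_thom : TambHom free_tambara S :=
  @MkTambHom G free_tambara S (fun X => evalR X s)
    (fun X Y f => eval_res f s) (fun X Y f => eval_tr f s)
    (fun X Y f => eval_nm f s).
Definition eval_hom : AlgHom free_alg S :=
  @MkAlgHom G k free_alg S eval_thom (fun X => eval_cst s).
End EvalHom.

Definition free_var j : free_alg (V j) := qcls (Var j).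

Lemma eval_var (S : Alg k) (s : forall j, S (V j)) j :
  eval_hom s (V j) (free_var j) = s j.
Proof.
rewrite [LHS]evalX_pi /evalX /= -(mk_res_comp (green_mackey S)) to_skK.
by rewrite (mk_res_id (green_mackey S)).
Qed.

(** The quotient in level [sg x] consists of terms over [sk (sg x)], not over [x], hence the
    restriction along [of_sk]. *)
Definition free_cls x (t : term x) : free_alg (sg x) :=
  qcls (Res (of_sk (sg x)) t).

Lemma eval_cls x (t : term x) (S : Alg k) (s : forall j, S (V j)) :
  eval_hom s (sg x) (free_cls t) = eval s t.
Proof.
rewrite [LHS]evalX_pi /evalX /= -(mk_res_comp (green_mackey S)) to_skK.
by rewrite (mk_res_id (green_mackey S)).
Qed.

Lemma free_clsE x (t : term x) : free_cls t = eval free_var t.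
Proof.
elim: t => {x} /= [x a|j|x t <- u <-|x t <-|x t <- u <-|x y f t <-|x y f t <-|x y f t <-];
  apply: evalR_inj => S s; rewrite [LHS]eval_cls /=.
- by rewrite eval_cst.
- by rewrite eval_res [evalR _ _ _]eval_var.
- by rewrite rmorphD ![evalR _ _ _]eval_cls.
- by rewrite rmorphN ![evalR _ _ _]eval_cls.
- by rewrite rmorphM ![evalR _ _ _]eval_cls.
- by rewrite eval_res ![evalR _ _ _]eval_cls.
- by rewrite eval_tr ![evalR _ _ _]eval_cls.
- by rewrite eval_nm ![evalR _ _ _]eval_cls.
Qed.

Lemma ahom_eval (S : Alg k) (u : AlgHom free_alg S) x (t : term x) :
  u (sg x) (eval free_var t) = eval (fun j => u (V j) (free_var j)) t.
Proof.
elim: t => {x} /=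
  [x a|j|x t <- u' <-|x t <-|x t <- u' <-|x y f t <-|x y f t <-|x y f t <-].
- exact: (ahom_in u).
- exact: (thom_res u).
- exact: rmorphD.
- exact: rmorphN.
- exact: rmorphM.
- exact: (thom_res u).
- exact: (thom_tr u).
- exact: (thom_nm u).
Qed.

(** Every element is, up to the isomorphism [to_sk X], the value of a term at the generators, and
    morphisms commute with the evaluation of terms. *)
Lemma free_hom_uniq (S : Alg k) (u v : AlgHom free_alg S) :
  (forall j, u (V j) (free_var j) = v (V j) (free_var j)) ->
  forall X a, u X a = v X a.
Proof.
move=> uv X a.
have -> : a = res free_alg (to_sk X) (free_cls (repr (a : polyT X))).
  apply: evalR_inj => S' s; rewrite eval_res; symmetry.
  exact: (congr1 (res S' (to_sk X)) (eval_cls _ s)).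
have euv : (fun j => u (V j) (free_var j)) = (fun j => v (V j) (free_var j)).
  by apply: functional_extensionality_dep.
by rewrite !thom_res free_clsE !ahom_eval euv.
Qed.
End Free.

Lemma free_exists (G : finGroupType) (k : Tambara G) n (V : 'I_n -> Gset G) :
  exists (F : Alg k) (x : forall j, F (V j)), is_free x.
Proof.
exists (free_alg k V), (free_var k V) => S s; exists (eval_hom s).
split=> [j|u us Y a]; first exact: eval_var.
by apply: free_hom_uniq => j; rewrite us eval_var.
Qed.

(** * Presentation of the coinduced algebra *)

Lemma nm1 (G : finGroupType) (S : Tambara G) (X Y : Gset G) (f : Gmap X Y) :
  nm (t := S) f 1 = 1.
Proof. by have [] := @nm_morph G S X Y f. Qed.

Lemma nmM (G : finGroupType) (S : Tambara G) (X Y : Gset G) (f : Gmap X Y) a b :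
  nm (t := S) f (a * b) = nm f a * nm f b.
Proof. by have [_] := @nm_morph G S X Y f; apply. Qed.

(** * Norms and disjoint unions *)

Section NormTools.
Variables (G : finGroupType) (T : Tambara G).
Implicit Types X Y Z : Gset G.

Lemma res_nm_mono X Y (f : Gmap X Y) (a : T X) : injective f -> res T f (nm f a) = a.
Proof.
move=> /mono_pullback/nm_pullback ->.
by rewrite nm_id (mk_res_id (green_mackey T)).
Qed.

Lemma res_nm_disjoint X Y Z (i : Gmap X Z) (j : Gmap Y Z) (a : T X) :
  (forall x y, i x <> j y) -> res T j (nm i a) = 1.
Proof.
move=> /disjoint_pullback/nm_pullback ->.
rewrite (_ : res T _ a = 1) ?nm1 //.
have T0 := @mk_empty _ _ _ _ (green_mackey T) (gempty G).
by rewrite [LHS]T0 ?[RHS]T0 //; case.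
Qed.

(** It suffices that [a] is the product of the norms along [i] and [j] of its restrictions; each of
    these norms is 1 on the other summand. *)
Lemma nm_coproduct X1 X2 X Y (i : Gmap X1 X) (j : Gmap X2 X) (f : Gmap X Y) (a : T X) :
  is_coproduct i j ->
  nm f a = nm (gcomp f i) (res T i a) * nm (gcomp f j) (res T j a).
Proof.
move=> ij; have [i_inj j_inj dij] := coproduct_inj ij.
have dji y x : j y <> i x by move=> e; apply: (dij x y).
rewrite !nm_comp -nmM; congr (nm f _).
apply: (mackey_coproduct_eq (green_mackey T) ij).
  rewrite [RHS](rmorphM (res T i)).
  by rewrite res_nm_mono // res_nm_disjoint // mulr1.
rewrite [RHS](rmorphM (res T j)).
by rewrite res_nm_disjoint // res_nm_mono // mul1r.
Qed.

Lemma nm_iso X Y (f : Gmap X Y) (g : Gmap Y X) (a : T X) :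
  gcomp f g = gid Y -> gcomp g f = gid X -> nm f a = res T g a.
Proof.
move=> fg gf; rewrite -[RHS]nm_id -[LHS](mk_res_id (green_mackey T)).
by apply: nm_pullback; apply: iso_pullback.
Qed.
End NormTools.

(** * Maps between G-sets of bounded size *)

Section SmallMaps.
Variable G : finGroupType.

Definition bounded : finType :=
  {n : 'I_#|G|.+1 & {a : {ffun 'I_n * G -> 'I_n} | small_act_ax a}}.

Definition bgset (x : bounded) : Gset G := gset_of_small (tagged x).

(** Equivariant maps are stored as finite tables, so that they can index a finite family of
    relations. *)
Definition bounded_map : finType :=
  {x : bounded & {y : bounded & {f : {ffun bgset x -> bgset y} |
    [forall u, forall g, f (gact (bgset x) u g) == gact (bgset y) (f u) g]}}}.

Definition bsrc (m : bounded_map) : Gset G := bgset (tag m).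
Definition btgt (m : bounded_map) : Gset G := bgset (tag (tagged m)).

Definition bfun (m : bounded_map) : {ffun bsrc m -> btgt m} := val (tagged (tagged m)).

Lemma bfun_act (m : bounded_map) (u : bsrc m) (g : G) :
  bfun m (gact (bsrc m) u g) = gact (btgt m) (bfun m u) g.
Proof.
case: m u => x [y [f fP]] u; apply/eqP.
exact: (forallP (forallP fP u) g).
Qed.

Definition bmap (m : bounded_map) : Gmap (bsrc m) (btgt m) := MkGmap (@bfun_act m).

Lemma bounded_mapP (X Y : Gset G) (f : Gmap X Y) :
  (#|X| <= #|G|)%N -> (#|Y| <= #|G|)%N ->
  exists (m : bounded_map) (a : Gmap X (bsrc m)) (a' : Gmap (bsrc m) X)
    (b : Gmap Y (btgt m)) (b' : Gmap (btgt m) Y),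
  [/\ gcomp a a' = gid _, gcomp a' a = gid _, gcomp b b' = gid _,
      gcomp b' b = gid _ & f = gcomp b' (gcomp (bmap m) a)].
Proof.
move=> leX leY.
pose bsk (Z : Gset G) (leZ : (#|Z| <= #|G|)%N) : bounded :=
  existT (fun n : 'I_#|G|.+1 => {a : {ffun 'I_n * G -> 'I_n} | small_act_ax a})
    (Ordinal (leZ : (#|Z| < #|G|.+1)%N)) (exist (@small_act_ax G #|Z|) _ (sk_act_ax Z)).
pose x := bsk X leX; pose y := bsk Y leY.
pose phi : {ffun bgset x -> bgset y} := [ffun u => sk_map f (u : sg (sk X))].
have phiP : [forall u, forall g, phi (gact (bgset x) u g) == gact (bgset y) (phi u) g].
  apply/forallP => u; apply/forallP => g; rewrite !ffunE.
  by rewrite -(gmapP (sk_map f)).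
pose m : bounded_map := existT _ x (existT _ y (exist _ phi phiP)).
exists m, (to_sk X), (of_sk X), (to_sk Y), (of_sk Y).
split; [exact: of_skK|exact: to_skK|exact: of_skK|exact: to_skK|].
apply: gmap_ext => u; rewrite !gcompE [bmap m _]ffunE /sk_map !gcompE.
have toK (Z : Gset G) v : of_sk Z (to_sk Z v) = v := gmap_funE v (to_skK Z).
by rewrite !toK.
Qed.
End SmallMaps.

(** * Morphisms out of [R] defined by one element *)

Section Corep.
Variables (G : finGroupType) (H : {group G}).

Local Notation F X := (igset (rgset H X)).
Local Notation Fm f := (igmap (rgmap H f)).
Local Notation eps X := (gcounit H X).
Local Notation diag X := (diag H X).
Local Notation pt := (gpt G).

Lemma eps_nat (X Y : Gset G) (f : Gmap X Y) x : eps Y (Fm f x) = f (eps X x).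
Proof. exact: gmap_funE (gcounit_nat H f). Qed.

Lemma eps_diag X x : eps (F X) (diag X x) = x.
Proof. exact: gmap_funE (counit_diag H X). Qed.

Lemma Feps_diag X x : Fm (eps X) (diag X x) = x.
Proof. exact: gmap_funE (ind_counit_diag H X). Qed.

Lemma Fm_comp (X Y Z : Gset G) (g : Gmap Y Z) (f : Gmap X Y) x :
  Fm (gcomp g f) x = Fm g (Fm f x).
Proof. by rewrite rgmap_comp igmap_comp. Qed.

(** [Fm f] preserves the coordinate in [G/H], and [eps X] gives the other coordinate. *)
Lemma F_ext (X Y : Gset G) (f : Gmap X Y) (x y : F X) :
  eps X x = eps X y -> Fm f x = Fm f y -> x = y.
Proof.
exact: pullback_ext (gcounit_pullback H f).
Qed.

Section Const.
Variables (X Y : Gset G) (f : Gmap X Y).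
Local Notation E := (expE f (eps X)).
Local Notation Z := (expZ f (eps X)).

(* [F X -> X] is [X x G/H -> X], and [c] sends [(y, t)] to the constant section
   [t] over the fibre of [f] at [y]. *)
Definition const_set (u : F Y) : {set F X} := [set a | Fm f a == u].

Lemma const_section (u : F Y) :
  is_section f (eps X) (eps Y u, const_set u).
Proof.
split=> [a|x fx].
  by rewrite /= inE => /eqP <-; exact/esym/eps_nat.
have [_ /(_ _ _ fx)[a [[ea fa] ua]]] := gcounit_pullback H f.
exists a; split; first by rewrite inE fa.
by move=> b [/[!inE]/eqP fb eb]; apply: ua.
Qed.

Definition const_fun (u : F Y) : E :=
  gsub_mk (@is_section_act _ _ _ _ f (eps X)) (const_section u).

Lemma mem_const_fun u a : (a \in exp_set (const_fun u)) = (Fm f a == u).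
Proof. by rewrite /exp_set /= inE. Qed.

Lemma const_subproof u g : const_fun (gact (F Y) u g) = gact E (const_fun u) g.
Proof.
apply: expE_inj; first exact: gmapP.
apply/setP => a; rewrite exp_set_act !mem_const_fun.
apply/eqP/eqP; [move=> e | move=> <-].
  by rewrite gmapP e gactK.
by rewrite gmapP gactKV.
Qed.

Definition const_map : Gmap (F Y) E := MkGmap const_subproof.

Lemma mem_const u a : (a \in exp_set (const_map u)) = (Fm f a == u).
Proof. exact: mem_const_fun. Qed.

Lemma const_q u : exp_q f (eps X) (const_map u) = eps Y u.
Proof. by []. Qed.

Lemma const_val_subproof (a : F X) : a \in exp_set (const_map (Fm f a)).
Proof. by rewrite mem_const. Qed.

Definition const_val_fun (a : F X) : Z :=
  gsub_mk (@exp_val_subproof _ _ _ _ f (eps X))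
    (x := (a, const_map (Fm f a))) (const_val_subproof a).

Lemma const_val_eqvar a g :
  const_val_fun (gact (F X) a g) = gact Z (const_val_fun a) g.
Proof. 
have fE b : exp_f f (eps X) (const_val_fun b) = const_map (Fm f b) by [].
apply: expZ_inj; first by [].
by rewrite gmapP !fE !gmapP.
 Qed.

Definition const_val : Gmap (F X) Z := MkGmap const_val_eqvar.

Lemma const_valE a : exp_e f (eps X) (const_val a) = a. Proof. by []. Qed.

Lemma const_valF a : exp_f f (eps X) (const_val a) = const_map (Fm f a).
Proof. by []. Qed.

Lemma const_pullback :
  is_pullback const_val (Fm f) (exp_f f (eps X)) const_map.
Proof.
split=> // z u ez; have fz : Fm f (exp_e f (eps X) z) = u.
  by apply/eqP; rewrite -mem_const -ez exp_eP.
exists (exp_e f (eps X) z); split; last by move=> a [<- _].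
by split=> //; apply: expZ_inj; rewrite ?const_valE ?const_valF ?fz.
Qed.
End Const.

Variable k : Tambara G.
Local Notation R := (CoIndT (ResT H k)).

Section Hom.
Variables (S : Alg k) (s : S (F pt)).

(** The element [s] in level [G/H], pulled back along the projection [X x G/H -> G/H]. *)
Definition spread X : S (F X) := res S (Fm (to_pt X)) s.

Lemma spread_res X Y (f : Gmap X Y) : res S (Fm f) (spread Y) = spread X.
Proof.
rewrite /spread -(mk_res_comp (green_mackey S)) -igmap_comp -rgmap_comp.
by congr (res S (Fm _) s); apply: gmap_ext.
Qed.

(** The formula is forced: in [R], [a] is the transfer of [a] times [delta], so a morphism sending
    [delta] to [s] takes this value. *)
Definition corep_fun X (a : R X) : S X := tr S (eps X) (alg_in S (F X) a * spread X).

Lemma corep_res X Y (f : Gmap X Y) (a : R Y) :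
  corep_fun (res R f a) = res S f (corep_fun a).
Proof.
rewrite /corep_fun -(spread_res f) [alg_in _ _ _]thom_res -rmorphM.
exact/esym/(mk_pullback (green_mackey S) (pullback_sym (gcounit_pullback H f))).
Qed.

Lemma corep_tr X Y (f : Gmap X Y) (a : R X) :
  corep_fun (tr R f a) = tr S f (corep_fun a).
Proof.
rewrite /corep_fun -(mk_tr_comp (green_mackey S)) -gcounit_nat.
rewrite (mk_tr_comp (green_mackey S)); congr (tr S (eps Y) _).
by rewrite [alg_in _ _ _]thom_tr -frobenius spread_res.
Qed.

Lemma corep_zmod X : zmod_morphism (@corep_fun X).
Proof.
move=> a b; rewrite /corep_fun -raddfB; congr (tr S _ _).
by rewrite -mulrBl -rmorphB.
Qed.

Lemma corep_in X (a : k X) :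
  corep_fun (coind_res_unit H k X a) = alg_in S X a * corep_fun 1.
Proof.
rewrite /corep_fun rmorph1 mul1r [RHS]mulrC -frobenius -thom_res.
by rewrite [in RHS]mulrC.
Qed.

Hypothesis s1 : tr S (eps pt) s = 1.
Hypothesis s_idem : res S (eps (F pt)) s * res S (Fm (eps pt)) s = tr S (diag pt) s.

Lemma spread1 X : tr S (eps X) (spread X) = 1.
Proof.
rewrite -(rmorph1 (res S (to_pt X))) -s1; apply/esym.
exact: (mk_pullback (green_mackey S) (pullback_sym (gcounit_pullback H (to_pt X)))).
Qed.

Lemma spread_idem X :
  res S (eps (F X)) (spread X) * res S (Fm (eps X)) (spread X) = tr S (diag X) (spread X).
Proof.
have /= e := congr1 (res S (Fm (Fm (to_pt X)))) s_idem.
rewrite (mk_pullback (green_mackey S) (pullback_sym (diag_pullback H (to_pt X)))) in e.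
rewrite -[RHS]e rmorphM; have rc := mk_res_comp (green_mackey S).
congr (_ * _); rewrite /spread -!rc; congr (res S _ s).
  by rewrite gcounit_nat.
by rewrite -!igmap_comp -!rgmap_comp gcounit_nat; congr (Fm _); apply: gmap_ext.
Qed.

Lemma corep1 X : corep_fun (1 : R X) = 1.
Proof. by rewrite /corep_fun rmorph1 mul1r spread1. Qed.

Lemma corep_unit X (a : k X) : corep_fun (coind_res_unit H k X a) = alg_in S X a.
Proof. by rewrite corep_in corep1 mulr1. Qed.

(** By base change the product of the two transfers is a transfer from [F (F X)], where [s_idem]
    concentrates it on the diagonal. *)
Lemma corepM X (a b : R X) : corep_fun (a * b) = corep_fun a * corep_fun b.
Proof.
have pb := gcounit_pullback H (eps X).
have M := green_mackey S; have rc := mk_res_comp M.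
rewrite /corep_fun -frobenius.
set a' := alg_in S (F X) a; set b' := alg_in S (F X) b.
rewrite (_ : res S (eps X) _ = tr S (Fm (eps X)) (res S (eps (F X)) (b' * spread X)));
  last exact: (mk_pullback M pb).
congr (tr S (eps X) _); rewrite [RHS]mulrC -frobenius !rmorphM.
(* The two copies of [spread] multiply to a transfer along [diag X], and both projections restrict
   to the identity there. *)
rewrite [in RHS]mulrACA spread_idem [X in tr S _ X]mulrC -frobenius.
rewrite -(mk_tr_comp M) ind_counit_diag (mk_tr_id M) rmorphM -!rc.
rewrite counit_diag ind_counit_diag !(mk_res_id M) mulrC; congr (_ * _).
by rewrite mulrC.
Qed.

Section Norm.
Variables (X Y : Gset G) (f : Gmap X Y).
Local Notation e := (exp_e f (eps X)).
Local Notation f' := (exp_f f (eps X)).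
Local Notation q := (exp_q f (eps X)).
Local Notation c := (const_map f).

(* The norm of [spread] along [f] lives on the sections of [F X -> X] over [f]; it
   has to vanish on the non-constant ones. *)
Definition norm_rel : Prop :=
  nm f' (res S e (spread X)) = tr S c (spread Y).

(** The exponential formula expresses the norm of the transfer as a transfer from the sections [E].
    The relation concentrates it on the constant sections, that is on [F Y], where the norm along
    [f'] becomes the norm along [Fm f]. *)
Lemma corep_nm_rel : norm_rel ->
  forall a : R X, corep_fun (nm f a) = nm f (corep_fun a).
Proof.
move=> rel a; rewrite /corep_fun (nm_tr (exp_exponential f (eps X))).
rewrite rmorphM; have [_ nmM] := @nm_morph G S _ _ f'.
rewrite nmM rel [X in _ = tr S _ X]mulrC -frobenius -(mk_tr_comp (green_mackey S)).
rewrite (_ : gcomp q c = eps Y); last by apply: gmap_ext.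
congr (tr S _ _); rewrite mulrC; congr (_ * _).
rewrite (nm_pullback (const_pullback f)) -(mk_res_comp (green_mackey S)).
rewrite (_ : gcomp e (const_val f) = gid _); last by apply: gmap_ext.
rewrite (mk_res_id (green_mackey S)); exact: thom_nm.
Qed.
End Norm.
End Hom.

End Corep.

(** * The relations satisfied by [delta] *)

Section Delta.
Variables (G : finGroupType) (H : {group G}) (k : Tambara G).

Local Notation F X := (igset (rgset H X)).
Local Notation Fm f := (igmap (rgmap H f)).
Local Notation eps X := (gcounit H X).
Local Notation diag X := (diag H X).
Local Notation pt := (gpt G).
Local Notation R := (CoIndT (ResT H k)).
Local Notation A := (MkAlg (coind_res_unit H k)).
Local Notation delta X := (delta H k X).

Lemma diag_coassoc (X : Gset G) :
  gcomp (diag (F X)) (diag X) = gcomp (Fm (diag X)) (diag X).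
Proof. by rewrite -!igmap_comp gunit_nat. Qed.

(** Both sides are the transfer of 1 along the triple diagonal [F X -> F (F (F X))]. *)
Lemma delta_idem_rel X :
  res A (eps (F X)) (delta X) * res A (Fm (eps X)) (delta X) = tr A (diag X) (delta X).
Proof.
have -> : res A (Fm (eps X)) (delta X) = delta (F X) by exact: delta_res.
rewrite mulrC [LHS]delta_mul_res scale_delta.
have tc := mk_tr_comp (green_mackey k).
transitivity (tr k (gcomp (diag (F X)) (diag X)) 1); first exact/esym/tc.
by rewrite diag_coassoc; exact: tc.
Qed.

Lemma spread_delta X : spread (S := A) (delta pt) X = delta X.
Proof. exact: delta_res. Qed.

Section Norm.
Variables (X Y : Gset G) (f : Gmap X Y).
Local Notation E := (expE f (eps X)).
Local Notation Z := (expZ f (eps X)).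
Local Notation e := (exp_e f (eps X)).
Local Notation f' := (exp_f f (eps X)).
Local Notation q := (exp_q f (eps X)).
Local Notation c := (const_map H f).

(* [j] sends [z] to [(z, t)] where [e z = (x, t)]. *)
Lemma exp_lift_ex (z : Z) : exists z' : F Z, eps Z z' = z /\ Fm e z' = diag X (e z).
Proof.
have [_ /(_ z (diag X (e z)))] := gcounit_pullback H e.
by rewrite eps_diag => /(_ erefl) [z' [? _]]; exists z'.
Qed.

Definition exp_lift_fun (z : Z) : F Z := projT1 (cid (exp_lift_ex z)).

Lemma eps_exp_lift z : eps Z (exp_lift_fun z) = z.
Proof. by rewrite /exp_lift_fun; case: cid => ? []. Qed.

Lemma Fe_exp_lift z : Fm e (exp_lift_fun z) = diag X (e z).
Proof. by rewrite /exp_lift_fun; case: cid => ? []. Qed.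

Lemma exp_lift_subproof z g : exp_lift_fun (gact Z z g) = gact (F Z) (exp_lift_fun z) g.
Proof.
apply: (F_ext (f := e)).
  by rewrite eps_exp_lift (gmapP (eps Z)) eps_exp_lift.
by rewrite Fe_exp_lift (gmapP (Fm e)) Fe_exp_lift (gmapP e) (gmapP (diag X)).
Qed.

Definition exp_lift : Gmap Z (F Z) := MkGmap exp_lift_subproof.

Lemma exp_lift_inj : injective exp_lift.
Proof. exact: can_inj eps_exp_lift. Qed.

(** This identifies [Z] with the preimage of the diagonal under [Fm e], so [delta] restricts along
    [Fm e] to the transfer of 1 along [exp_lift]. *)
Lemma exp_lift_pullback : is_pullback e exp_lift (diag X) (Fm e).
Proof.
split=> [z|a z' ez]; first exact/esym/Fe_exp_lift.
have ea : e (eps Z z') = a by rewrite -eps_nat -ez eps_diag.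
exists (eps Z z'); split.
  split=> //; apply: (F_ext (f := e)); first exact: eps_exp_lift.
  by rewrite [LHS]Fe_exp_lift ea.
by move=> z [_ <-]; exact: eps_exp_lift.
Qed.

(** The map sending [(y, t)] to the pair of the constant section [t] over [y] and [t] itself. *)
Definition const_diag : Gmap (F Y) (F E) := gcomp (Fm c) (diag Y).

Lemma Fq_const_diag u : Fm q (const_diag u) = u.
Proof.
rewrite gcompE -Fm_comp (_ : gcomp q c = eps Y); first exact: Feps_diag.
exact: gmap_ext.
Qed.

Lemma eps_const_diag u : eps E (const_diag u) = c u.
Proof. by rewrite gcompE eps_nat eps_diag. Qed.

Lemma exp_lift_val : gcomp exp_lift (const_val H f) = gcomp (Fm (const_val H f)) (diag X).
Proof.
apply: gmap_ext => a; rewrite !gcompE; apply: (F_ext (f := e)).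
  by rewrite eps_exp_lift eps_nat eps_diag.
rewrite Fe_exp_lift -Fm_comp (_ : gcomp e (const_val H f) = gid _).
  by rewrite rgmap_id igmap_id.
exact: gmap_ext.
Qed.

(** Think of [v] as a section with a coset [t]. A point of [F Z] over [v] picks a value of the
    section, and it lies in the image of [exp_lift] only if this value has coset [t]; so the section
    is constant with value [t]. *)
Lemma const_diag_onto (v : F E) :
  (forall z' : F Z, Fm f' z' = v -> exists z, exp_lift z = z') ->
  const_diag (Fm q v) = v.
Proof.
move=> lift; set u := Fm q v; apply: (F_ext (f := q)); last exact: Fq_const_diag.
rewrite eps_const_diag; have qv : q (eps E v) = eps Y u by rewrite eps_nat.
have sub a : a \in exp_set (eps E v) -> Fm f a = u.
  move=> /expZ_ex [z ez fz].
  have [_ /(_ z v fz) [z' [[eps_z' fz'] _]]] := gcounit_pullback H f'.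
  have [z1 ez1] := lift _ fz'.
  have ezz : z1 = z by rewrite -eps_z' -ez1; exact/esym/eps_exp_lift.
  have Fez' : Fm e z' = diag X a by rewrite -ez1 -ez ezz; exact: Fe_exp_lift.
  rewrite /u -fz' -Fm_comp.
  rewrite (_ : gcomp q f' = gcomp f (gcomp (eps X) e)).
    rewrite (Fm_comp f (gcomp (eps X) e)) (Fm_comp (eps X) e) Fez'.
    by rewrite Feps_diag.
  by apply: gmap_ext => z2; exact: esym (exp_setP (exp_eP z2)).
apply: expE_inj; first by rewrite const_q qv.
(* Both graphs contain exactly one point over each point of the fibre, so one inclusion yields
   equality. *)
apply/setP => a; rewrite mem_const; apply/eqP/idP => [fa|/sub//].
have [|b [[bv eb] _]] := @exp_set_uniq _ _ _ _ f (eps X) (eps E v) (eps X a).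
  by rewrite qv -fa eps_nat.
suff -> : a = b by exact: bv.
by apply: (F_ext (f := f)); [exact: esym eb | rewrite fa (sub b bv)].
Qed.

(** [exp_lift] is injective, so it has at most one section over a fibre of [Fm f'], and one exists
    only if the fibre lies in its image. By [const_diag_onto] this singles out the image of
    [const_diag]. *)
Lemma const_diag_exponential :
  is_exponential (Fm f') exp_lift (const_val H f) (Fm f) const_diag.
Proof.
split.
  rewrite exp_lift_val; apply: pullback_paste (diag_pullback H f) _.
  have pb : is_pullback (rgmap H (const_val H f)) (rgmap H (Fm f))
    (rgmap H f') (rgmap H c) := const_pullback H f.
  exact: igmap_pullback pb.
move=> v s sP; have vE : const_diag (Fm q v) = v.
  apply: const_diag_onto => z' /eqP fz'.
  by exists (s (exist _ z' fz')); rewrite sP.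
exists (Fm q v); split=> [|t [dt _]].
  split=> [|a _ h]; first exact: vE.
  have eh := sP (exist (fun z' => Fm f' z' == v) _ h).
  by apply: exp_lift_inj; exact: esym eh.
by rewrite -dt; exact: Fq_const_diag.
Qed.

Lemma delta_norm_rel : norm_rel (S := A) (delta pt) f.
Proof.
rewrite /norm_rel !spread_delta.
have e1 : res k (Fm e) (tr k (diag X) 1) = tr k exp_lift 1.
  apply: etrans (mk_pullback (green_mackey k) exp_lift_pullback 1) _.
  by congr (tr k exp_lift _); exact: rmorph1.
have e2 : nm (t := k) (Fm f') (tr k exp_lift 1) = tr k const_diag 1.
  rewrite (nm_tr const_diag_exponential); congr (tr k const_diag _).
  rewrite rmorph1; exact: nm1.
apply: etrans (congr1 (nm (t := k) (Fm f')) e1) _; apply: etrans e2 _.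
exact: (mk_tr_comp (green_mackey k)).
Qed.
End Norm.
End Delta.

(** * The finite presentation *)

Section CorepHom.
Variables (G : finGroupType) (H : {group G}) (k : Tambara G).

Local Notation F X := (igset (rgset H X)).
Local Notation Fm f := (igmap (rgmap H f)).
Local Notation eps X := (gcounit H X).
Local Notation diag X := (diag H X).
Local Notation pt := (gpt G).
Local Notation R := (CoIndT (ResT H k)).
Local Notation A := (MkAlg (coind_res_unit H k)).
Local Notation delta X := (delta H k X).

(** [None] is the relation on the total transfer and [Some None] the orthogonality and idempotence
    of the conjugates; the remaining indices are the norm relations, one for each bounded map. *)
Definition rel_index : finType := option (option (bounded_map G)).

Definition rel_level (i : rel_index) : Gset G :=
  match i with
  | None => pt
  | Some None => F (F pt)
  | Some (Some m) => expE (bmap m) (eps (bsrc m))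
  end.

Section Rel.
Variables (S : Alg k) (s : S (F pt)).

Definition rel_lhs (i : rel_index) : S (rel_level i) :=
  match i with
  | None => tr S (eps pt) s
  | Some None => res S (eps (F pt)) s * res S (Fm (eps pt)) s
  | Some (Some m) => nm (exp_f (bmap m) (eps (bsrc m)))
      (res S (exp_e (bmap m) (eps (bsrc m))) (spread s (bsrc m)))
  end.

Definition rel_rhs (i : rel_index) : S (rel_level i) :=
  match i with
  | None => 1
  | Some None => tr S (diag pt) s
  | Some (Some m) => tr S (const_map H (bmap m)) (spread s (btgt m))
  end.
End Rel.

Section RelHom.
Variables (S T : Alg k) (t : AlgHom S T) (s : S (F pt)).

Lemma rel_lhs_hom i : t (rel_level i) (rel_lhs s i) = rel_lhs (t (F pt) s) i.
Proof.
case: i => [[m|]|] /=; first by rewrite thom_nm !thom_res.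
  by rewrite rmorphM !thom_res.
by rewrite thom_tr.
Qed.

Lemma rel_rhs_hom i : t (rel_level i) (rel_rhs s i) = rel_rhs (t (F pt) s) i.
Proof.
case: i => [[m|]|] /=; first by rewrite thom_tr thom_res.
  by rewrite thom_tr.
by rewrite rmorph1.
Qed.
End RelHom.

Lemma delta_rel i : rel_lhs (S := A) (delta pt) i = rel_rhs (S := A) (delta pt) i.
Proof.
case: i => [[m|]|].
- exact: delta_norm_rel.
- exact: delta_idem_rel.
- exact: tr_delta.
Qed.

Section Hom.
Variables (S : Alg k) (s : S (F pt)).
Hypothesis s_rel : forall i, rel_lhs s i = rel_rhs s i.

Let s1 : tr S (eps pt) s = 1 := s_rel None.
Let s_idem : res S (eps (F pt)) s * res S (Fm (eps pt)) s = tr S (diag pt) s :=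
  s_rel (Some None).

Local Notation w := (corep_fun s).

Definition commutes_nm X Y (f : Gmap X Y) : Prop :=
  forall a : R X, w (nm f a) = nm f (w a).

Lemma commutes_nm_comp X Y Z (g : Gmap Y Z) (f : Gmap X Y) :
  commutes_nm f -> commutes_nm g -> commutes_nm (gcomp g f).
Proof. by move=> cf cg a; rewrite !nm_comp cg cf. Qed.

Lemma commutes_nm_iso X Y (f : Gmap X Y) (g : Gmap Y X) :
  gcomp f g = gid Y -> gcomp g f = gid X -> commutes_nm f.
Proof.
by move=> fg gf a; rewrite !(nm_iso _ fg gf) corep_res.
Qed.

Lemma commutes_nm_bounded X Y (f : Gmap X Y) :
  (#|X| <= #|G|)%N -> (#|Y| <= #|G|)%N -> commutes_nm f.
Proof.
move=> leX leY; have [m [a [a' [b [b' [aK Ka bK Kb ->]]]]]] := bounded_mapP f leX leY.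
apply: commutes_nm_comp; last exact: commutes_nm_iso Kb bK.
apply: commutes_nm_comp; first exact: commutes_nm_iso aK Ka.
by move=> u; apply: corep_nm_rel; exact: (s_rel (Some (Some m))).
Qed.

(** The norm along [f] is the product of the norms from the two summands, and [w] is
    multiplicative. *)
Lemma commutes_nm_source X1 X2 X Y (i : Gmap X1 X) (j : Gmap X2 X) (f : Gmap X Y) :
  is_coproduct i j -> commutes_nm (gcomp f i) -> commutes_nm (gcomp f j) ->
  commutes_nm f.
Proof.
move=> ij fi fj a; rewrite !(nm_coproduct _ _ ij) (corepM s_idem).
by rewrite fi fj !corep_res.
Qed.

(** Restrictions to [Y1] and [Y2] detect equality, and base change computes them from the pullbacks
    of [f]. *)
Lemma commutes_nm_target X Y1 Y2 Y (i : Gmap Y1 Y) (j : Gmap Y2 Y) (f : Gmap X Y) :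
  is_coproduct i j -> commutes_nm (gpb_r f i) -> commutes_nm (gpb_r f j) ->
  commutes_nm f.
Proof.
have step Y' (i' : Gmap Y' Y) : commutes_nm (gpb_r f i') ->
    forall a, res S i' (w (nm f a)) = res S i' (nm f (w a)).
  move=> fi a; have pb := gpb_pullback f i'.
  by rewrite -corep_res !(nm_pullback pb) fi corep_res.
move=> ij fi fj a.
by apply: (mackey_coproduct_eq (green_mackey S) ij); apply: step.
Qed.

Lemma corep_nm X Y (f : Gmap X Y) : commutes_nm f.
Proof.
have [n] := ubnP (#|X| + #|Y|); elim: n X Y f => // n IH X Y f le.
(* Splitting the target decreases it without enlarging the source; once the target is bounded,
   splitting the source leaves it unchanged. Either way the total size drops. *)
have [leY|[Y1 [Y2 [i [j [ij lt1 lt2]]]]]] := gset_split Y; last first.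
  have [i_inj j_inj _] := coproduct_inj ij.
  by apply: (commutes_nm_target ij); apply: IH;
    apply: leq_trans (le : _ <= n)%N; rewrite -addnS leq_add ?card_gpb.
have [leX|[X1 [X2 [i [j [ij lt1 lt2]]]]]] := gset_split X; last first.
  by apply: (commutes_nm_source ij); apply: IH;
    apply: leq_trans (le : _ <= n)%N; rewrite ltn_add2r.
exact: commutes_nm_bounded.
Qed.

HB.instance Definition _ X :=
  GRing.isZmodMorphism.Build (R X) (S X) (@corep_fun _ H k S s X)
    (@corep_zmod _ H k S s X).

Lemma corep_monoid X : monoid_morphism (@corep_fun _ H k S s X).
Proof. by split=> [|a b]; [exact: corep1 | exact: corepM]. Qed.

HB.instance Definition _ X :=
  GRing.isMonoidMorphism.Build (R X) (S X) (@corep_fun _ H k S s X) (corep_monoid X).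

Definition corep_thom : TambHom R S :=
  @MkTambHom G R S (fun X => @corep_fun _ H k S s X)
    (fun X Y f => corep_res s f) (fun X Y f => corep_tr s f) corep_nm.

Definition corep_hom : AlgHom A S :=
  @MkAlgHom G k A S corep_thom (fun X => corep_unit s1 (X := X)).

Lemma corep_delta : corep_hom (F pt) (delta pt) = s.
Proof.
have M := green_mackey S.
have e : res S (diag pt) (spread s (F pt)) = s.
  (* Maps to [pt] are unique, so the restriction is along [Fm (eps pt)] composed with [diag pt], the
     identity. *)
  rewrite /spread -(mk_res_comp M) (_ : to_pt (F pt) = eps pt).
    by rewrite ind_counit_diag (mk_res_id M).
  by apply: gmap_ext => u; case: (eps pt u).
transitivity (tr S (eps (F pt)) (tr S (diag pt) 1 * spread s (F pt))).
  congr (tr S _ (_ * _)).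
  by apply: etrans (thom_tr (alg_in S) (diag pt) 1) _; rewrite rmorph1.
by rewrite -frobenius mul1r e -(mk_tr_comp M) counit_diag (mk_tr_id M).
Qed.
End Hom.

(** A morphism of algebras preserves the expression of [a] as a transfer of [a] times [delta], so
    its value at [delta] determines it. *)
Lemma corep_uniq (S : Alg k) (u : AlgHom A S) X (a : R X) :
  u X a = corep_fun (u (F pt) (delta pt)) a.
Proof.
rewrite -[a in LHS]tr_scale_delta [LHS](thom_tr u) /corep_fun; congr (tr S _ _).
rewrite algm_scaleE rmorphM; congr (_ * _); first exact: (ahom_in u).
by rewrite -(spread_delta H k X) [LHS](thom_res u).
Qed.

Lemma coind_finitely_presented : finitely_presented A.
Proof.
pose V (_ : 'I_1) := F pt; pose W (j : 'I_#|rel_index|) := rel_level (enum_val j).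
have [P [x Px]] := free_exists k V; have [E [y Ey]] := free_exists k W.
pose x0 := x ord0.
have [u [u_y _]] := Ey P (fun j => rel_lhs x0 (enum_val j)).
have [v [v_y _]] := Ey P (fun j => rel_rhs x0 (enum_val j)).
have [q [q_x _]] := Px A (fun _ => delta pt).
exists 1%N, V, P, x, #|rel_index|, W, E, y, u, v, q; split=> //; split=> [X a|S t tuv].
  (* The composites [q u] and [q v] out of the free algebra [E] agree as soon as they agree on
     generators, where the equality is [delta_rel]. *)
  have [z [_ zU]] := Ey A (fun j => q (W j) (u (W j) (y j))).
  rewrite -[LHS]/(ahom_comp q u X a) -[RHS]/(ahom_comp q v X a).
  rewrite (zU (ahom_comp q u)) // (zU (ahom_comp q v)) // => j /=.
  rewrite u_y v_y; apply: etrans (rel_rhs_hom q x0 _) _.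
  by apply/esym; apply: etrans (rel_lhs_hom q x0 _) _; rewrite [q _ x0]q_x delta_rel.
(* The image [s] of the generator satisfies the relations because [t] equalizes [u] and [v]. *)
pose s := t (F pt) x0.
have s_rel i : rel_lhs s i = rel_rhs s i.
  rewrite -(enum_rankK i) -rel_lhs_hom -rel_rhs_hom.
  by have := tuv _ (y (enum_rank i)); rewrite u_y v_y.
(* Both [t] and the composite of [q] with the new morphism send the generator of [P] to [s], hence
   coincide. *)
have [z [_ zU]] := Px S (fun _ => s).
have xE j : t (V j) (x j) = s by rewrite [j]ord1.
exists (corep_hom s_rel); split=> [X a|w' w'E X a].
  rewrite -[LHS]/(ahom_comp (corep_hom s_rel) q X a).
  rewrite (zU (ahom_comp (corep_hom s_rel) q)) ?(zU t) // => j /=.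
  by rewrite q_x corep_delta.
rewrite corep_uniq (corep_uniq (corep_hom s_rel)) corep_delta.
by rewrite -(q_x ord0) w'E.
Qed.
End CorepHom.

Theorem theorem1 (G : finGroupType) (k : Tambara G) (H : {group G}) :
  etale (coind_res_unit H k).
Proof. split; [exact: coind_formally_etale | exact: coind_finitely_presented]. Qed.
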